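(* Let $n=2$. Let $\hat x=(\hat r,\hat q,\hat p)\in X_h$ be the solution of $\langle \mathcal{B}\hat x,\tilde x\rangle=\langle f,\tilde x\rangle$ for all $\tilde x\in X_h$, and let $x_h=(r_h,q_h,p_h)\in X_h$ be the solution of the problem with quadrature $\langle \mathcal{B}_h x_h,\tilde x\rangle=\langle f,\tilde x\rangle$ for all $\tilde x\in X_h$. Then the vorticity is unaffected by the quadrature rule, i.e. $r_h=\hat r$.
   Context: Setting. $\Omega\subset\mathbb{R}^2$ is a simply connected Lipschitz domain with outward unit normal $\nu$; $\mu>0$ is a constant; $g\in (L^2(\Omega))^2$. The boundary is disjointly decomposed as $\partial\Omega=\partial_p\Omega\cup\partial_q\Omega$, and boundary data $p_0,q_0$ are given (such that the functional $f$ below is bounded). It is assumed that $\partial_p\Omega\neq\emptyset$ and $\|\nu\cdot\phi\|_{\partial_q\Omega}+\|\nu\times\phi\|_{\partial_p\Omega}>0$ for all rigid body motions $\phi\neq0$. $\|\cdot\|$ and $\langle\cdot,\cdot\rangle_\Omega$ are the $L^2(\Omega)$ norm and inner product. In two dimensions $\nabla\times r=[\partial_2 r,-\partial_1 r]^T$ for scalar $r$, $\nabla\times q=\partial_1q_2-\partial_2q_1$ for vector $q$, the cross product with $\nu$ is defined analogously, and the vorticity $r$ is a scalar. Continuous spaces and forms. $X=R\times Q\times P$ with $R=\{r\in H(\mathrm{curl},\Omega):\nu\times r|_{\partial_q\Omega}=0\}$, $Q=\{q\in H(\mathrm{div},\Omega):\nu\cdot q|_{\partial_q\Omega}=0\}$,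 $P=L^2(\Omega)$. For $x=(r,q,p)$, $\tilde x=(\tilde r,\tilde q,\tilde p)\in X$, $$\langle\mathcal{B}x,\tilde x\rangle=\langle\mu^{-1}r,\tilde r\rangle_\Omega-\langle q,\nabla\times\tilde r\rangle_\Omega+\langle\nabla\times r,\tilde q\rangle_\Omega-\langle p,\nabla\cdot\tilde q\rangle_\Omega+\langle\nabla\cdot q,\tilde p\rangle_\Omega,$$ $$\langle f,\tilde x\rangle=\langle q_0,\nu\times\tilde r\rangle_{\partial_p\Omega}+\langle g,\tilde q\rangle_\Omega-\langle p_0,\nu\cdot\tilde q\rangle_{\partial_p\Omega}.$$ Discretization. $\Omega_h$ is a triangular mesh of $\Omega$ (from a shape-regular family) with mesh size $h$. $X_h=R_h\times Q_h\times P_h$, where $R_h$ is the space of continuous piecewise linear Lagrange elements intersected with $R$, $Q_h$ is the lowest-order Raviart–Thomas space intersected with $Q$, and $P_h$ is the space of piecewise constants. One has $\nabla\times R_h\subseteq Q_h$ and $\nabla\cdot Q_h=P_h$. Quadrature. For elementwise linear (possibly discontinuous) scalar functions $r,\tilde r$ on $\Omega_h$, $$\langle r,\tilde r\rangle_h=\sum_{\omega\in\Omega_h}\frac{|\omega|}{3}\sum_{v\in\mathcal V(\omega)}(r_\omega\,\tilde r_\omega)(v),$$ with $r_\omega$ the restriction of $r$ to the triangle $\omega$ and $\mathcal V(\omega)$ its set of vertices. $\mathcal{B}_h$ is obtained from $\mathcal{B}$ on $X_h$ by replacing $\langle\mu^{-1}r,\tilde r\rangle_\Omega$ by $\langle\mu^{-1}r,\tilde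 r\rangle_h$. *)

(* Defs.v *)
(* MathComp / MathComp-Analysis *)
From HB Require Import structures.
From mathcomp Require Import all_boot all_order all_algebra.
From mathcomp Require Import all_classical all_reals all_analysis.
Set Implicit Arguments.
Unset Strict Implicit.
Unset Printing Implicit Defensive.
Import Order.TTheory GRing.Theory Num.Theory numFieldNormedType.Exports.
Local Open Scope classical_set_scope.
Local Open Scope ring_scope.

Notation plane R := (R * R)%type.

Section Plane.
Context {R : realType}.
Implicit Types (u v x y : plane R) (a : R).

Definition dot u v : R := u.1 * v.1 + u.2 * v.2.
Definition enorm u : R := Num.sqrt (dot u u).

(* The two cross products of the plane: nu x v (a scalar) for a vector v, and
   nu x a = [nu_2 a, - nu_1 a] for a scalar a. *)
Definition crossv u v : R := u.1 * v.2 - u.2 * v.1.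
Definition crosss u a : plane R := (u.2 * a, - (u.1 * a)).

Definition leb2 := (@lebesgue_measure R \x @lebesgue_measure R)%E.

Definition int2 (D : set (plane R)) (f : plane R -> R) : R :=
  \int[leb2]_(x in D) f x.

Definition meas2 (D : set (plane R)) : Prop :=
  measurable (D : set (measurableTypeR R * measurableTypeR R)).

Definition L2 (D : set (plane R)) (f : plane R -> R) : Prop :=
  measurable_fun (D : set (measurableTypeR R * measurableTypeR R))
    (f : _ -> measurableTypeR R) /\
  leb2.-integrable D (EFin \o (fun x => f x ^+ 2)).

Definition L2v (D : set (plane R)) (f : plane R -> plane R) : Prop :=
  L2 D (fun x => (f x).1) /\ L2 D (fun x => (f x).2).

Definition bdry (Omega : set (plane R)) : set (plane R) :=
  closure Omega `&` closure (~` Omega).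

Definition simply_connected (Omega : set (plane R)) : Prop :=
  connected Omega /\
  forall c : R -> plane R, {within `[0, 1]%classic, continuous c} ->
    (forall t, t \in `[0, 1] -> Omega (c t)) -> c 0 = c 1 ->
    exists H : R -> R -> plane R, exists z : plane R,
      [/\ {within `[0, 1]%classic `*` `[0, 1]%classic,
            continuous (fun st => H st.1 st.2)},
          forall s t, s \in `[0, 1] -> t \in `[0, 1] -> Omega (H s t),
          forall s, s \in `[0, 1] -> H s 0 = H s 1 &
          forall t, t \in `[0, 1] -> H 0 t = c t /\ H 1 t = z].

(* Near each boundary point Omega is, in coordinates rotated by the unit vector
   e, the strict epigraph of a Lipschitz function. *)
Definition lipschitz_boundary (Omega : set (plane R)) : Prop :=
  forall x, bdry Omega x ->
    exists (e : plane R) (L : R) (gam : R -> R),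
      [/\ enorm e = 1,
          forall s t, `|gam s - gam t| <= L * `|s - t| &
          \forall y \near x,
            Omega y <-> gam (crossv e (y - x)) < dot e (y - x)].

Definition lipschitz_domain (Omega : set (plane R)) : Prop :=
  [/\ Omega !=set0, open Omega, bounded_set Omega, connected Omega &
      lipschitz_boundary Omega].

Definition d1 (f : plane R -> R) : plane R -> R := fun x => 'D_(1, 0) f x.
Definition d2 (f : plane R -> R) : plane R -> R := fun x => 'D_(0, 1) f x.

Fixpoint Ck (k : nat) (f : plane R -> R) : Prop :=
  continuous f /\
  if k is k'.+1 then
    [/\ forall x, derivable f x (1, 0), forall x, derivable f x (0, 1),
        Ck k' (d1 f) & Ck k' (d2 f)]
  else True.

Definition smooth (f : plane R -> R) : Prop := forall k, Ck k f.
Definition smoothv (f : plane R -> plane R) : Prop :=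
  smooth (fun x => (f x).1) /\ smooth (fun x => (f x).2).

Definition cgrad (f : plane R -> R) : plane R -> plane R :=
  fun x => (d1 f x, d2 f x).
Definition ccurl (f : plane R -> plane R) : plane R -> R :=
  fun x => d1 (fun y => (f y).2) x - d2 (fun y => (f y).1) x.

Definition vanishes_near (V : zmodType) (S : set (plane R))
    (f : plane R -> V) : Prop :=
  exists U : set (plane R), [/\ open U, S `<=` U & forall x, U x -> f x = 0].

Definition compactly_supported (V : zmodType) (D : set (plane R))
    (f : plane R -> V) : Prop :=
  exists K : set (plane R),
    [/\ compact K, K `<=` D & forall x, ~ K x -> f x = 0].

(* c is the distributional curl [d_2 r, - d_1 r] of the scalar r, and s the
   distributional divergence of q; both are required to be in L^2. *)
Definition is_curl (D : set (plane R)) (r : plane R -> R)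
    (c : plane R -> plane R) : Prop :=
  L2v D c /\
  forall phi, smoothv phi -> compactly_supported D phi ->
    int2 D (fun x => r x * ccurl phi x) = int2 D (fun x => dot (c x) (phi x)).

Definition is_div (D : set (plane R)) (q : plane R -> plane R)
    (s : plane R -> R) : Prop :=
  L2 D s /\
  forall psi, smooth psi -> compactly_supported D psi ->
    int2 D (fun x => dot (q x) (cgrad psi x)) = - int2 D (fun x => s x * psi x).

Definition Hcurl D (r : plane R -> R) : Prop := L2 D r /\ exists c, is_curl D r c.
Definition Hdiv D (q : plane R -> plane R) : Prop :=
  L2v D q /\ exists s, is_div D q s.

(* Representatives of the (a.e. unique) weak curl and weak divergence. *)
Definition curl D r : plane R -> plane R := xget (fun=> 0) [set c | is_curl D r c].
Definition div D q : plane R -> R := xget (fun=> 0) [set s | is_div D q s].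

(* <nu x r, phi>_{bd D} and <nu . q, psi>_{bd D}, the tangential and normal
   traces as functionals, defined as usual by Green's formula. *)
Definition ttrace_pair D (r : plane R -> R) (phi : plane R -> plane R) : R :=
  int2 D (fun x => dot (curl D r x) (phi x)) - int2 D (fun x => r x * ccurl phi x).
Definition ntrace_pair D (q : plane R -> plane R) (psi : plane R -> R) : R :=
  int2 D (fun x => dot (q x) (cgrad psi x)) + int2 D (fun x => div D q x * psi x).

(* The trace conditions on bd_q say that the trace functionals annihilate the
   test functions that vanish in a neighbourhood of bd_p. *)
Definition spaceR (Omega bdp : set (plane R)) (r : plane R -> R) : Prop :=
  Hcurl Omega r /\
  forall phi, smoothv phi -> vanishes_near bdp phi -> ttrace_pair Omega r phi = 0.
Definition spaceQ (Omega bdp : set (plane R)) (q : plane R -> plane R) : Prop :=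
  Hdiv Omega q /\
  forall psi, smooth psi -> vanishes_near bdp psi -> ntrace_pair Omega q psi = 0.
Definition spaceP (Omega : set (plane R)) (p : plane R -> R) : Prop := L2 Omega p.

End Plane.

Record triple (R : realType) := Triple {
  vort : plane R -> R;
  velo : plane R -> plane R;
  pres : plane R -> R }.

Section Mesh.
Context {R : realType}.

(* Vertices of each cell are numbered counterclockwise. *)
Definition cell_det (v : 'I_3 -> plane R) : R :=
  crossv (v (inord 1) - v (inord 0)) (v (inord 2) - v (inord 0)).

(* Convex hull of the vertices whose index is in A. *)
Definition face (v : 'I_3 -> plane R) (A : {set 'I_3}) : set (plane R) :=
  [set x | exists l : 'I_3 -> R,
     [/\ forall k, 0 <= l k, forall k, k \notin A -> l k = 0,
         \sum_k l k = 1 &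
         x = (\sum_k l k * (v k).1, \sum_k l k * (v k).2)]].

Definition triangle (v : 'I_3 -> plane R) : set (plane R) :=
  face v [set: 'I_3]%SET.

(* Indices of the vertices of v that are also vertices of w. *)
Definition shared (v w : 'I_3 -> plane R) : {set 'I_3} :=
  [set k | [exists j, v k == w j]]%SET.

(* Conforming triangulation: distinct cells meet in the hull of their common
   vertices, that is in nothing, a common vertex or a common edge. *)
Record mesh (Omega : set (plane R)) := Mesh {
  cell : finType;
  vtx : cell -> 'I_3 -> plane R;
  vtx_ccw : forall w, 0 < cell_det (vtx w);
  mesh_cover : closure Omega = \bigcup_(w in [set: cell]) triangle (vtx w);
  mesh_distinct : forall w w', w != w' ->
    shared (vtx w) (vtx w') != [set: 'I_3]%SET;
  mesh_conforming : forall w w', w != w' ->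
    triangle (vtx w) `&` triangle (vtx w') `<=`
      face (vtx w) (shared (vtx w) (vtx w')) }.

Variables (Omega : set (plane R)) (Th : mesh Omega).
Implicit Types (w : cell Th) (k : 'I_3).

Definition area w : R := cell_det (vtx w) / 2.

(* Edge k of w runs from vertex k to the cyclically next vertex. *)
Definition edge_dir w k : plane R := vtx w (ordS k) - vtx w k.
Definition edge_len w k : R := enorm (edge_dir w k).
Definition edge_pt w k (t : R) : plane R :=
  ((1 - t) * (vtx w k).1 + t * (vtx w (ordS k)).1,
   (1 - t) * (vtx w k).2 + t * (vtx w (ordS k)).2).
Definition edge_normal w k : plane R :=
  ((edge_dir w k).2 / edge_len w k, - ((edge_dir w k).1 / edge_len w k)).

(* diam w <= sigma * (diameter of the inscribed circle = 4 |w| / perimeter). *)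
Definition shape_regular (sigma : R) : Prop :=
  forall w k, edge_len w k * (\sum_j edge_len w j) <= sigma * (4 * area w).

Definition bdry_edge (e : cell Th * 'I_3) : Prop :=
  forall t, t \in `[0, 1] -> bdry Omega (edge_pt e.1 e.2 t).

(* Parameters of the points of S on an edge. *)
Definition edge_part (S : set (plane R)) (e : cell Th * 'I_3) : set R :=
  [set t | t \in `[0, 1] /\ S (edge_pt e.1 e.2 t)].

(* Arc length integral over S `<=` bdry Omega, by edgewise parametrization; the
   integrand F takes the outward unit normal and the boundary point. *)
Definition bint (S : set (plane R)) (F : plane R -> plane R -> R) : R :=
  \sum_(e : cell Th * 'I_3 | `[< bdry_edge e >])
    edge_len e.1 e.2 *
    \int[lebesgue_measure]_(t in edge_part S e)
       F (edge_normal e.1 e.2) (edge_pt e.1 e.2 t).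

Definition bintegrable (S : set (plane R)) (F : plane R -> plane R -> R) : Prop :=
  forall e : cell Th * 'I_3, bdry_edge e ->
    (@lebesgue_measure R).-integrable (edge_part S e)
      (fun t => (F (edge_normal e.1 e.2) (edge_pt e.1 e.2 t))%:E).

Definition bL2 (u : plane R -> R) : Prop :=
  forall e : cell Th * 'I_3, bdry_edge e ->
    measurable_fun (`[0, 1]%classic : set (measurableTypeR R))
      (u \o edge_pt e.1 e.2 : _ -> measurableTypeR R) /\
    (@lebesgue_measure R).-integrable `[0, 1]
      (fun t => (u (edge_pt e.1 e.2 t) ^+ 2)%:E).

Definition bnorm (S : set (plane R)) (F : plane R -> plane R -> R) : R :=
  Num.sqrt (bint S (fun nu x => F nu x ^+ 2)).

Definition rigid_motion (phi : plane R -> plane R) : Prop :=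
  exists (a : plane R) (b : R), forall x, phi x = (a.1 - b * x.2, a.2 + b * x.1).

Definition no_rigid_motion (bdp bdq : set (plane R)) : Prop :=
  forall phi, rigid_motion phi -> (exists x, phi x != 0) ->
    0 < bnorm bdq (fun nu x => dot nu (phi x)) +
        bnorm bdp (fun nu x => crossv nu (phi x)).

(* Traces that are square integrable functions on the boundary (as they are for
   all finite element functions): t = nu x r, respectively w = nu . q. *)
Definition is_ttrace (r : plane R -> R) (t : plane R -> plane R) : Prop :=
  [/\ bL2 (fun x => (t x).1), bL2 (fun x => (t x).2) &
  forall phi, smoothv phi ->
    ttrace_pair Omega r phi = bint (bdry Omega) (fun _ x => dot (t x) (phi x))].
Definition is_ntrace (q : plane R -> plane R) (w : plane R -> R) : Prop :=
  bL2 w /\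
  forall psi, smooth psi ->
    ntrace_pair Omega q psi = bint (bdry Omega) (fun _ x => w x * psi x).
Definition ttrace (r : plane R -> R) : plane R -> plane R :=
  xget (fun=> 0) [set t | is_ttrace r t].
Definition ntrace (q : plane R -> plane R) : plane R -> R :=
  xget (fun=> 0) [set w | is_ntrace q w].

Definition spaceX (bdp : set (plane R)) (x : triple R) : Prop :=
  [/\ spaceR Omega bdp (vort x), spaceQ Omega bdp (velo x) &
      spaceP Omega (pres x)].

Definition normX (x : triple R) : R :=
  Num.sqrt (int2 Omega (fun z =>
    vort x z ^+ 2 + dot (curl Omega (vort x) z) (curl Omega (vort x) z) +
    dot (velo x z) (velo x z) + div Omega (velo x) z ^+ 2 + pres x z ^+ 2)).

Definition bilB (mu : R) (x y : triple R) : R :=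
  int2 Omega (fun z => mu^-1 * vort x z * vort y z)
  - int2 Omega (fun z => dot (velo x z) (curl Omega (vort y) z))
  + int2 Omega (fun z => dot (curl Omega (vort x) z) (velo y z))
  - int2 Omega (fun z => pres x z * div Omega (velo y) z)
  + int2 Omega (fun z => div Omega (velo x) z * pres y z).

Definition load (bdp : set (plane R)) (q0 : plane R -> plane R)
    (p0 : plane R -> R) (g : plane R -> plane R) (y : triple R) : R :=
  bint bdp (fun _ z => dot (q0 z) (ttrace (vort y) z))
  + int2 Omega (fun z => dot (g z) (velo y z))
  - bint bdp (fun _ z => p0 z * ntrace (velo y) z).

(* Boundedness of the load on X, tested where its boundary terms are integrals;
   such y are dense in X. *)
Definition load_bounded (bdp : set (plane R)) (q0 : plane R -> plane R)
    (p0 : plane R -> R) (g : plane R -> plane R) : Prop :=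
  exists C : R, forall y : triple R, spaceX bdp y ->
    (exists t, is_ttrace (vort y) t) -> (exists u, is_ntrace (velo y) u) ->
    [/\ bintegrable bdp (fun _ z => dot (q0 z) (ttrace (vort y) z)),
        bintegrable bdp (fun _ z => p0 z * ntrace (velo y) z) &
        `|load bdp q0 p0 g y| <= C * normX y].

(* Membership in H(curl) and in H(div), hence continuity of the normal
   component across edges, comes from the intersection with R and Q. Fields in
   L^2 are prescribed on the open triangles only, the edges being negligible. *)
Definition lagrange1 (r : plane R -> R) : Prop :=
  {within closure Omega, continuous r} /\
  forall w, exists a b c : R, forall x, triangle (vtx w) x ->
    r x = a + b * x.1 + c * x.2.
Definition raviart_thomas0 (q : plane R -> plane R) : Prop :=
  Hdiv Omega q /\
  forall w, exists (a : plane R) (b : R), forall x, (triangle (vtx w))° x ->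
    q x = (a.1 + b * x.1, a.2 + b * x.2).
Definition piecewise_constant (p : plane R -> R) : Prop :=
  forall w, exists a : R, forall x, (triangle (vtx w))° x -> p x = a.

Definition spaceRh bdp (r : plane R -> R) : Prop :=
  lagrange1 r /\ spaceR Omega bdp r.
Definition spaceQh bdp (q : plane R -> plane R) : Prop :=
  raviart_thomas0 q /\ spaceQ Omega bdp q.
Definition spacePh (p : plane R -> R) : Prop :=
  piecewise_constant p /\ spaceP Omega p.
Definition spaceXh bdp (x : triple R) : Prop :=
  [/\ spaceRh bdp (vort x), spaceQh bdp (velo x) & spacePh (pres x)].

(* <r, s>_h for elementwise functions, r w being the restriction to w extended
   to its vertices. *)
Definition quad (r s : cell Th -> plane R -> R) : R :=
  \sum_w area w / 3 * \sum_k r w (vtx w k) * s w (vtx w k).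

Definition bilBh (mu : R) (x y : triple R) : R :=
  quad (fun _ z => mu^-1 * vort x z) (fun _ => vort y)
  - int2 Omega (fun z => dot (velo x z) (curl Omega (vort y) z))
  + int2 Omega (fun z => dot (curl Omega (vort x) z) (velo y z))
  - int2 Omega (fun z => pres x z * div Omega (velo y) z)
  + int2 Omega (fun z => div Omega (velo x) z * pres y z).

End Mesh.

(* Main.v *)
Require Import Defs.
From HB Require Import structures.
From mathcomp Require Import all_boot all_order all_algebra.
From mathcomp Require Import all_classical all_reals all_analysis.
From mathcomp Require Import measurable_realfun.
From mathcomp Require Import ring lra.
Set Implicit Arguments.
Unset Strict Implicit.
Unset Printing Implicit Defensive.
Import Order.TTheory GRing.Theory Num.Theory numFieldNormedType.Exports.
Local Open Scope classical_set_scope.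
Local Open Scope ring_scope.

(** The load is the same in both problems, so [bilBh xh y = bilB xhat y] for
    every discrete [y], and the two forms differ in the vorticity mass term
    only. Let [d] be the difference of the two discrete vorticities.

    Take first [y = (0, c, 0)], where [c] is the elementwise constant curl of
    [d]. This is an admissible test triple: [c] is divergence free because mixed
    second derivatives commute, and its normal trace against [psi] is the
    tangential trace of [d] against the gradient of [psi], so that it inherits
    the boundary condition of [d]. The mass terms do not see [y], and what is
    left of the difference of the equations is that the square of the norm of
    [c] vanishes. So [d] is constant on every triangle; being continuous with
    finitely many values on a connected set, it is a constant [kap].

    Take then [y = (d, 0, 0)]. The velocity terms drop out because the curl of
    [d] is zero. The vertex rule is exact for an elementwise linear function
    times a constant, so the quadrature may be replaced by the integral, and the
    difference of the equations reads [mu^-1 * kap ^+ 2 * |Omega| = 0], that is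
    [kap = 0]. This argument treats alike the case where the boundary condition
    already forces a constant to vanish and the case where constants are
    admissible.

    The curl and the divergence in the forms are arbitrary representatives of
    weak derivatives, so the computations above rest on their uniqueness almost
    everywhere, that is on the fundamental lemma of the calculus of variations
    ([ae_eq0_of_test]). The weak curl of an elementwise linear function is then
    identified on one open triangle at a time ([is_curl_elementwise]), by
    integration by parts against test fields supported there. Passing from
    triangles to the domain uses that the open triangles are disjoint, lie in
    the Lipschitz domain, and cover it up to a null set ([int2_mesh]). Exactness
    of the vertex rule ([quadrature_exact]) reduces, by an affine change of
    variables, to one integral over the reference triangle. *)

(** * Lebesgue measure on the plane *)

HB.instance Definition _ (R : realType) := Measure.on (@leb2 R).

#[global] Instance ae_leb2_filter (R : realType) :
  Filter (almost_everywhere (@leb2 R)).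
Proof. exact: ae_filter_ringOfSetsType. Qed.

Section PlaneMeasure.
Context {R : realType}.
Local Notation mR := (measurableTypeR R).
Local Notation mplane := (measurableTypeR R * measurableTypeR R)%type.
Implicit Types (D : set (plane R)) (f : plane R -> R).

(** The closed rectangles lie in [D], so that bumps supported on them are test
    functions on [D], while the open ones cover [D]. *)
Lemma open_rect_cover D : open D -> exists a b c d : nat -> R,
  (forall n, `[a n, b n]%classic `*` `[c n, d n]%classic `<=` D) /\
  D `<=` \bigcup_n (`]a n, b n[%classic `*` `]c n, d n[%classic).
Proof.
move=> oD.
pose good (q : (rat * rat) * (rat * rat)) :=
  `[< `[ratr q.1.1, ratr q.1.2 : R]%classic `*`
      `[ratr q.2.1, ratr q.2.2 : R]%classic `<=` D >].
pose pk n : (R * R) * (R * R) :=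
  if unpickle n is Some q then
    if good q then ((ratr q.1.1, ratr q.1.2), (ratr q.2.1, ratr q.2.2))
    else ((1, 0), (1, 0))
  else ((1, 0), (1, 0)).
exists (fun n => (pk n).1.1), (fun n => (pk n).1.2),
  (fun n => (pk n).2.1), (fun n => (pk n).2.2).
(* Indices that code no admissible rectangle get the empty one, from 1 to 0. *)
have dflt : `[1, 0 : R]%classic `*` `[1, 0 : R]%classic `<=` D.
  move=> [x y] [/=]; rewrite in_itv/= => /andP[] /le_trans /[apply].
  by rewrite ler10.
split=> [n|[x y] Dxy].
  rewrite /pk; case: (unpickle n) => [q|//].
  by case: ifPn => // /asboolP.
have /nbhs_ballP[e /= e0 eD] := open_nbhs_nbhs (conj oD Dxy).
have rp (z : R) : exists2 p : rat * rat, ratr p.1 < z < ratr p.2 &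
    forall u, ratr p.1 <= u <= ratr p.2 -> `|z - u| < e.
  have [p1 /[!in_itv]/= /andP[p1a p1b]] : exists p, ratr p \in `]z - e, z[.
    by apply: rat_in_itvoo; rewrite ltrBlDr ltrDl.
  have [p2 /[!in_itv]/= /andP[p2a p2b]] : exists p, ratr p \in `]z, z + e[.
    by apply: rat_in_itvoo; rewrite ltrDl.
  exists (p1, p2) => /=; first by rewrite p1b p2a.
  by move=> u /andP[u1 u2]; rewrite ltr_norml; apply/andP; split; lra.
have [p pz pe] := rp x; have [q qz qe] := rp y.
have gpq : good (p, q).
  apply/asboolP => -[u v] [/= ux vy]; apply: eD; split => /=.
    by apply: pe; move: ux; rewrite in_itv.
  by apply: qe; move: vy; rewrite in_itv.
have pkE : pk (pickle (p, q)) =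
    ((ratr p.1, ratr p.2), (ratr q.1, ratr q.2)) by rewrite /pk pickleK gpq.
exists (pickle (p, q)); first exact: I.
by rewrite pkE; split; rewrite /= in_itv.
Qed.

Lemma open_meas2 D : open D -> meas2 D.
Proof.
move=> oD; have [a [b [c [d [sub sup]]]]] := open_rect_cover oD.
have -> : D = \bigcup_n (`]a n, b n[%classic `*` `]c n, d n[%classic).
  apply/seteqP; split=> // -[x y] [n _ [/= xab ycd]].
  by apply: (sub n); split => /=; exact: subset_itv_oo_cc.
by apply: bigcupT_measurable => n; apply: measurableX; exact: measurable_itv.
Qed.

Lemma continuous_meas2 f : continuous f ->
  measurable_fun setT (f : mplane -> R).
Proof.
move=> /continuousP cf; apply: (measurability _ (measurable_realfun.RGenOpens.measurableE R)).
move=> _ [_ [a [b ->] <-]]; rewrite setTI; apply: open_meas2.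
exact/cf/interval_open.
Qed.

Lemma leb2_rect (a b c d : R) :
  (leb2 (`[a, b]%classic `*` `[c, d]%classic) < +oo)%E.
Proof.
rewrite /leb2 product_measure1E; [|exact: measurable_itv|exact: measurable_itv].
rewrite /= !lebesgue_measure_itv /=.
by do 2 case: ifP => _; rewrite ?mule0 ?mul0e ?ltry// -EFinB -?EFinM ltry.
Qed.

Lemma compact_rect (a b c d : R) :
  compact (`[a, b]%classic `*` `[c, d]%classic : set (plane R)).
Proof. by apply: compact_setX; exact: segment_compact. Qed.

Lemma bounded_subset_rect D : bounded_set D ->
  exists M : R, D `<=` `[- M, M]%classic `*` `[- M, M]%classic.
Proof.
move=> [M [Mr DM]]; exists (M + 1) => -[x y] Dxy.
have : `|(x, y)| <= M + 1 by apply: DM => //; rewrite ltrDl.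
rewrite prod_normE /= ge_max => /andP[xM yM].
by split; rewrite /= in_itv/= -ler_norml.
Qed.

Lemma bounded_leb2_lty D : meas2 D -> bounded_set D -> (leb2 D < +oo)%E.
Proof.
move=> mD /bounded_subset_rect[M DM].
apply: le_lt_trans (leb2_rect (- M) M (- M) M).
by apply: le_measure; rewrite ?inE//; apply: measurableX; exact: measurable_itv.
Qed.

Lemma compact_closure_bounded D : bounded_set D -> compact (closure D).
Proof.
move=> /bounded_subset_rect[M DM].
apply: (subclosed_compact _ (@compact_rect (- M) M (- M) M)).
  exact: closed_closure.
have /closure_id -> : closed (`[- M, M]%classic `*` `[- M, M]%classic : set (plane R)).
  apply: compact_closed; [|exact: compact_rect].
  exact: norm_hausdorff.
exact: closure_subset.
Qed.

Lemma continuous_bounded D f : bounded_set D -> continuous f ->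
  [bounded f x | x in D].
Proof.
move=> bD cf.
have : bounded_set (f @` closure D).
  apply: compact_bounded; apply: continuous_compact; last exact: compact_closure_bounded.
  exact: continuous_subspaceT.
move=> [M [Mr fM]]; exists M; split => // x Mx y Dy.
by apply: fM Mx _ _; exists y => //; exact: subset_closure.
Qed.

End PlaneMeasure.

(** * Smooth functions and bumps *)

Section Flat.
Context {R : realType}.
Implicit Types (p : {poly R}) (x t : R).

(** The functions [p(1/x) exp(-1/x)], extended by zero. Keeping the polynomial
    general makes the family closed under differentiation, so that the smoothness
    of [exp(-1/x)] is an induction on the order of differentiation. *)
Definition flat p x : R := if 0 < x then p.[x^-1] * expR (- x^-1) else 0.

Lemma flat_gt0 p x : 0 < x -> flat p x = p.[x^-1] * expR (- x^-1).
Proof. by move=> x0; rewrite /flat x0. Qed.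

Lemma flat_le0 p x : x <= 0 -> flat p x = 0.
Proof. by move=> x0; rewrite /flat ltNge x0. Qed.

(** This is [t / n <= expR (t / n)] raised to the power [n]. *)
Lemma expn_expR_bound n t : 0 <= t -> t ^+ n * expR (- t) <= n%:R ^+ n.
Proof.
move=> t0; rewrite expRN ler_pdivrMr ?expR_gt0//.
case: n => [|n]; first by rewrite !expr0 mul1r -expR0 ler_expR.
have n0 : 0 < n.+1%:R :> R by rewrite ltr0n.
have -> : expR t = expR (t / n.+1%:R) ^+ n.+1.
  by rewrite -expRM_natl mulrC divfK ?gt_eqF.
rewrite -exprMn lerXn2r ?nnegrE// ?mulr_ge0 ?expR_ge0//.
rewrite -ler_pdivrMl// mulrC; apply: le_trans (expR_ge1Dx _).
by rewrite lerDr.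
Qed.

Lemma poly_expR_bounded p : exists C, forall t, 0 <= t ->
  `|p.[t] * expR (- t)| <= C.
Proof.
exists (\sum_(i < size p) `|p`_i| * i%:R ^+ i) => t t0.
rewrite horner_coef mulr_suml; apply: le_trans (ler_norm_sum _ _ _) _.
apply: ler_sum => i _; rewrite -mulrA normrM ler_wpM2l//.
rewrite ger0_norm ?mulr_ge0 ?exprn_ge0 ?expR_ge0//.
exact: expn_expR_bound.
Qed.

(** A quadratic bound is what makes the derivative at the origin vanish. *)
Lemma flat_quadratic p : exists C, forall x, `|flat p x| <= C * x ^+ 2.
Proof.
have [C pC] := poly_expR_bounded ('X^2 * p).
have C0 : 0 <= C by apply: le_trans (normr_ge0 _) (pC 0 (lexx _)).
exists C => x; rewrite /flat; case: ifPn => [x0|_]; last first.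
  by rewrite normr0 mulr_ge0// sqr_ge0.
have := pC x^-1; rewrite invr_ge0 ltW// => /(_ isT).
rewrite hornerM hornerXn -mulrA normrM ger0_norm ?sqr_ge0// exprVn.
by rewrite ler_pdivrMl ?exprn_gt0// [C * _]mulrC.
Qed.

Lemma is_derive_flat p x :
  is_derive x 1 (flat p) (flat ('X^2 * (p - p^`())) x).
Proof.
have [x0|x0|->] := ltgtP x 0.
- rewrite [flat (_ * _) x]flat_le0 ?ltW//.
  apply: (@near_eq_is_derive _ _ _ (cst 0)).
  by near=> z; rewrite flat_le0 ?ltW//; near: z; exact: lt_nbhsl.
- have dV : is_derive x 1 (fun z : R => z^-1) (- x ^- 2).
    have := is_deriveV (lt0r_neq0 x0) (is_derive_id x (1 : R)).
    by rewrite scaler1.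
  have dVN : is_derive x 1 (fun z : R => - z^-1) (x ^- 2).
    by have := is_deriveN dV; rewrite opprK.
  have dp := is_derive1_comp (is_derive_poly p x^-1) dV.
  have de : is_derive x 1 (expR \o (fun z : R => - z^-1))
      (expR (- x^-1) * x ^- 2).
    exact: is_derive1_comp (is_derive_expR _) dVN.
  have := is_deriveM dp de.
  have -> : (horner p \o GRing.inv) x *: (expR (- x^-1) * x ^- 2) +
      (expR \o (fun z : R => - z^-1)) x *: (p^`().[x^-1] * - x ^- 2) =
      flat ('X^2 * (p - p^`())) x.
    by rewrite flat_gt0//= !hornerE /GRing.scale /=; field; exact: lt0r_neq0.
  move=> dF; apply: near_eq_is_derive dF.
  by near=> z; rewrite flat_gt0//; near: z; exact: lt_nbhsr.
- have [C pC] := flat_quadratic p.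
  have f0 q : flat q 0 = 0 by rewrite /flat ltxx.
  have C0 : 0 <= C.
    by have := pC 1; rewrite expr1n mulr1; apply: le_trans.
  suff H : (h^-1 *: ((flat p \o shift 0) (h *: (1 : R)) - flat p 0)) @[h --> 0^'] --> (0 : R).
    by rewrite f0; apply: DeriveDef; [exact: cvgP H | exact: cvg_lim H].
  rewrite f0; apply/cvgr0Pnorm_le => e e0.
  have eC : 0 < e / (C + 1) by rewrite divr_gt0// ltr_wpDl.
  near=> h; have h0 : h != 0 by near: h; exact: nbhs_dnbhs_neq.
  rewrite /= addr0 subr0 normrZ normfV /GRing.scale /= mulr1.
  rewrite ler_pdivrMl ?normr_gt0//; apply: le_trans (pC h) _.
  rewrite -real_normK ?num_real// expr2 mulrCA ler_wpM2l//.
  have : `|h| <= e / (C + 1).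
    near: h; exact: dnbhs0_le.
  rewrite ler_pdivlMr ?ltr_wpDl//; apply: le_trans.
  by rewrite mulrC ler_wpM2l// lerDl.
Unshelve. all: end_near. Qed.

End Flat.

Section Smooth.
Context {R : realType}.
Implicit Types (f g : plane R -> R) (x v : plane R).

(** A directional derivative depends only on the restriction to a line, which
    reduces it to one variable. *)
Lemma is_derive_line f x v (g : R -> R) (l : R) :
  (forall h, f (h *: v + x) = g h) ->
  is_derive (0 : R) (1 : R) g l -> is_derive x v f l.
Proof.
move=> fg [dg dgl].
have E : (fun h => h^-1 *: ((f \o shift x) (h *: v) - f x)) =
         (fun h => h^-1 *: ((g \o shift 0) (h *: (1 : R)) - g 0)).
  apply/funext => h /=; rewrite fg -[in f x](add0r x) -(scale0r v) fg.
  by rewrite addr0 [h%:A]mulr1.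
by split; rewrite /derivable /derive E.
Qed.

Lemma Ck_continuous k f : Ck k f -> continuous f.
Proof. by case: k => [|k] [cf _]. Qed.

Lemma Ck_pred k f : Ck k.+1 f -> Ck k f.
Proof.
elim: k f => [|k IH] f [cf]; first by move=> _; split.
move=> [df1 df2 h1 h2]; split; first exact: cf.
exact: (And4 df1 df2 (IH _ h1) (IH _ h2)).
Qed.

Lemma Ck_cst k (a : R) : Ck k (fun=> a).
Proof.
elim: k a => [|k IH] a; first by split => // x; exact: cvg_cst.
split; first by move=> x; exact: cvg_cst.
split=> [x|x||]; [exact: derivable_cst|exact: derivable_cst| |].
- by rewrite (_ : d1 _ = fun=> 0)//; apply/funext => x; exact: derive_cst.
- by rewrite (_ : d2 _ = fun=> 0)//; apply/funext => x; exact: derive_cst.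
Qed.

Lemma CkD k f g : Ck k f -> Ck k g -> Ck k (fun x => f x + g x).
Proof.
elim: k f g => [|k IH] f g [cf Hf] [cg Hg].
  by split=> // x; exact: (@continuousD _ _ _ f g x (cf x) (cg x)).
split; first by move=> x; exact: (@continuousD _ _ _ f g x (cf x) (cg x)).
case: Hf Hg => [f1 f2 Hf1 Hf2] [g1 g2 Hg1 Hg2].
split=> [x|x||].
- exact: (derivableD (f1 x) (g1 x)).
- exact: (derivableD (f2 x) (g2 x)).
- rewrite (_ : d1 _ = fun x => d1 f x + d1 g x); first exact: IH.
  by apply/funext => x; exact: (deriveD (f1 x) (g1 x)).
- rewrite (_ : d2 _ = fun x => d2 f x + d2 g x); first exact: IH.
  by apply/funext => x; exact: (deriveD (f2 x) (g2 x)).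
Qed.

Lemma CkM k f g : Ck k f -> Ck k g -> Ck k (fun x => f x * g x).
Proof.
elim: k f g => [|k IH] f g Hf Hg.
  case: Hf Hg => [cf _] [cg _].
  by split=> // x; exact: (@continuousM _ _ f g x (cf x) (cg x)).
have Hf' := Ck_pred Hf; have Hg' := Ck_pred Hg.
case: Hf Hg => [cf [f1 f2 Hf1 Hf2]] [cg [g1 g2 Hg1 Hg2]].
split; first by move=> x; exact: (@continuousM _ _ f g x (cf x) (cg x)).
split=> [x|x||].
- exact: (derivableM (f1 x) (g1 x)).
- exact: (derivableM (f2 x) (g2 x)).
- rewrite (_ : d1 _ = fun x => f x * d1 g x + g x * d1 f x).
    by apply: CkD; exact: IH.
  by apply/funext => x; exact: (deriveM (f1 x) (g1 x)).
- rewrite (_ : d2 _ = fun x => f x * d2 g x + g x * d2 f x).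
    by apply: CkD; exact: IH.
  by apply/funext => x; exact: (deriveM (f2 x) (g2 x)).
Qed.

Definition aff (a b c : R) x : R := a + b * x.1 + c * x.2.

Lemma is_derive_aff_comp (g : R -> R) (l a b c : R) x v :
  is_derive (aff a b c x) 1 g l ->
  is_derive x v (fun y => g (aff a b c y)) (l * (b * v.1 + c * v.2)).
Proof.
move=> dg; pose s := b * v.1 + c * v.2.
apply: (@is_derive_line _ _ _ (g \o (fun h => aff a b c x + s * h))).
  move=> h /=; congr (g _); rewrite /aff /s.
  have -> : (h *: v + x).1 = h * v.1 + x.1 by [].
  have -> : (h *: v + x).2 = h * v.2 + x.2 by [].
  ring.
have ds : is_derive (0 : R) (1 : R) (fun h => aff a b c x + s * h) s.
  have := is_deriveD (is_derive_cst (aff a b c x) (0 : R) (1 : R))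
     (is_deriveZ s (is_derive_id (0 : R) (1 : R))).
  by rewrite add0r [s%:A]mulr1.
by apply: is_derive1_comp; rewrite mulr0 addr0.
Qed.

Lemma continuous_aff a b c : continuous (aff a b c).
Proof.
move=> x; apply: (@continuousD _ _ _ (fun x => a + b * x.1) (fun x => c * x.2)).
  apply: (@continuousD _ _ _ (fun x => a) (fun x => b * x.1)).
    exact: cvg_cst.
  by apply: (@continuousM _ _ (fun=> b) fst); [exact: cvg_cst|exact: cvg_fst].
by apply: (@continuousM _ _ (fun=> c) snd); [exact: cvg_cst|exact: cvg_snd].
Qed.

(** Differentiating multiplies by a constant and changes the polynomial. *)
Lemma Ck_flat_aff k p (a b c : R) : Ck k (fun x => flat p (aff a b c x)).
Proof.
have cf q : continuous (fun x => flat q (aff a b c x)).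
  move=> x; apply: (@continuous_comp _ _ _ (aff a b c) (flat q)).
    exact: continuous_aff.
  apply: differentiable_continuous; apply/derivable1_diffP.
  by have [] := is_derive_flat q (aff a b c x).
elim: k p => [|k IH] p; first by split.
have D v x := is_derive_aff_comp v (is_derive_flat p (aff a b c x)).
split=> //; split=> [x|x||].
- by have [] := D (1, 0) x.
- by have [] := D (0, 1) x.
- rewrite (_ : d1 _ = fun x => flat ('X^2 * (p - p^`())) (aff a b c x) * b).
    by apply: CkM; [exact: IH|exact: Ck_cst].
  apply/funext => x; rewrite /d1; have [_ ->] := D (1, 0) x.
  by rewrite /= mulr1 mulr0 addr0.
- rewrite (_ : d2 _ = fun x => flat ('X^2 * (p - p^`())) (aff a b c x) * c).
    by apply: CkM; [exact: IH|exact: Ck_cst].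
  apply/funext => x; rewrite /d2; have [_ ->] := D (0, 1) x.
  by rewrite /= mulr1 mulr0 add0r.
Qed.

Lemma smoothM f g : smooth f -> smooth g -> smooth (fun x => f x * g x).
Proof. by move=> sf sg k; apply: CkM. Qed.

Lemma smooth_cst (a : R) : smooth (fun=> a).
Proof. by move=> k; exact: Ck_cst. Qed.

Lemma smooth_flat p a b c : smooth (fun x => flat p (aff a b c x)).
Proof. by move=> k; exact: Ck_flat_aff. Qed.

Lemma smooth_d1 f : smooth f -> smooth (d1 f).
Proof. by move=> sf k; have [_ []] := sf k.+1. Qed.

Lemma smooth_d2 f : smooth f -> smooth (d2 f).
Proof. by move=> sf k; have [_ []] := sf k.+1. Qed.

Lemma smooth_aff a b c : smooth (aff a b c).
Proof.
case=> [|k]; first by split => //; exact: continuous_aff.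
have D v x := @is_derive_aff_comp _ _ a b c x v (is_derive_id _ _).
split; first exact: continuous_aff.
split=> [x|x||].
- by have [] := D (1, 0) x.
- by have [] := D (0, 1) x.
- rewrite (_ : d1 _ = fun=> b); first exact: Ck_cst.
  apply/funext => x; rewrite /d1; have [_] := D (1, 0) x.
  by rewrite /= mulr1 mulr0 addr0 mul1r.
- rewrite (_ : d2 _ = fun=> c); first exact: Ck_cst.
  apply/funext => x; rewrite /d2; have [_] := D (0, 1) x.
  by rewrite /= mulr1 mulr0 add0r mul1r.
Qed.

End Smooth.

(** * Slices and mixed derivatives *)

Section Sections.
Context {R : realType}.
Implicit Types (f : plane R -> R).

Lemma is_derive_slice1 f (s t : R) : derivable f (s, t) (1, 0) ->
  is_derive s (1 : R) (fun u => f (u, t)) (d1 f (s, t)).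
Proof.
have E : (fun h => h^-1 *: (((fun u => f (u, t)) \o shift s) (h *: (1 : R)) - f (s, t))) =
         (fun h => h^-1 *: ((f \o shift (s, t)) (h *: (1, 0) : plane R) - f (s, t))).
  apply/funext => h /=; congr (_ *: (f _ - _)).
  by congr (_, _); rewrite /= ?[h *: 0]mulr0 ?add0r.
by move=> df; split; rewrite /derivable /derive E.
Qed.

Lemma is_derive_slice2 f (s t : R) : derivable f (s, t) (0, 1) ->
  is_derive t (1 : R) (fun u => f (s, u)) (d2 f (s, t)).
Proof.
have E : (fun h => h^-1 *: (((fun u => f (s, u)) \o shift t) (h *: (1 : R)) - f (s, t))) =
         (fun h => h^-1 *: ((f \o shift (s, t)) (h *: (0, 1) : plane R) - f (s, t))).
  apply/funext => h /=; congr (_ *: (f _ - _)).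
  by congr (_, _); rewrite /= ?[h *: 0]mulr0 ?add0r.
by move=> df; split; rewrite /derivable /derive E.
Qed.

Lemma MVT_increment (g dg : R -> R) (a h : R) : 0 < h ->
  (forall x, is_derive x (1 : R) g (dg x)) ->
  exists2 c, a < c < a + h & g (a + h) - g a = dg c * h.
Proof.
move=> h0 dgP; have := @MVT R g dg a (a + h).
rewrite ltrDl addrAC subrr add0r => /(_ h0 (fun x _ => dgP x)) [|c].
  by apply: derivable_within_continuous => x _; have [] := dgP x.
by rewrite in_itv /= => cab ->; exists c.
Qed.

(** Mean value theorem for the increment in the second variable as a function of
    the first one, then in the second variable. *)
Lemma increment21 f (a b h : R) : Ck 2 f -> 0 < h ->
  exists s t, [/\ a < s < a + h, b < t < b + h &
    f (a + h, b + h) - f (a + h, b) - f (a, b + h) + f (a, b) =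
    d2 (d1 f) (s, t) * h * h].
Proof.
move=> [_ [f1 f2 [_ [f11 f12 _ _]] _]] h0.
have dF s : is_derive s (1 : R) (fun u => f (u, b + h) - f (u, b))
    (d1 f (s, b + h) - d1 f (s, b)).
  by apply: is_deriveB; exact: is_derive_slice1.
have [s sa Es] := MVT_increment a h0 dF.
have [t tb Et] := MVT_increment b h0 (fun t => is_derive_slice2 (f12 (s, t))).
exists s, t; split=> //; rewrite -Et -Es; ring.
Qed.

Lemma increment12 f (a b h : R) : Ck 2 f -> 0 < h ->
  exists s t, [/\ a < s < a + h, b < t < b + h &
    f (a + h, b + h) - f (a + h, b) - f (a, b + h) + f (a, b) =
    d1 (d2 f) (s, t) * h * h].
Proof.
move=> [_ [f1 f2 _ [_ [f11 f12 _ _]]]] h0.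
have dF t : is_derive t (1 : R) (fun u => f (a + h, u) - f (a, u))
    (d2 f (a + h, t) - d2 f (a, t)).
  by apply: is_deriveB; exact: is_derive_slice2.
have [t tb Et] := MVT_increment b h0 dF.
have [s sa Es] := MVT_increment a h0 (fun s => is_derive_slice1 (f11 (s, t))).
exists s, t; split=> //; rewrite -Es -Et; ring.
Qed.

(** Either mixed derivative at some point of a small square is the second
    difference over that square divided by its area; the square shrinks. *)
Lemma schwarz f : Ck 2 f -> d1 (d2 f) = d2 (d1 f).
Proof.
move=> Hf; have [_ [_ _ [_ [_ _ _ [c21 _]]] [_ [_ _ [c12 _] _]]]] := Hf.
apply/funext => -[a b]; apply/eqP; rewrite -subr_eq0 -normr_le0.
apply/ler_addgt0Pr => e e0; rewrite add0r.
have e2 : 0 < e / 2 by rewrite divr_gt0.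
have /nbhs_ballP[u /= u0 Hu] : \forall y \near (a, b),
    `|d1 (d2 f) (a, b) - d1 (d2 f) y| < e / 2.
  by have /cvgrPdist_lt := c12 (a, b); apply.
have /nbhs_ballP[v /= v0 Hv] : \forall y \near (a, b),
    `|d2 (d1 f) (a, b) - d2 (d1 f) y| < e / 2.
  by have /cvgrPdist_lt := c21 (a, b); apply.
pose h := Num.min u v.
have h0 : 0 < h by rewrite lt_min u0.
have B s t w : a < s < a + h -> b < t < b + h -> h <= w -> ball (a, b) w (s, t).
  move=> /andP[sa sb] /andP[ta tb] hw.
  by split=> /=; rewrite /ball /= ltr_norml; apply/andP; split; lra.
have [s [t [sa tb Est]]] := increment12 a b Hf h0.
have [s' [t' [sa' tb' Est']]] := increment21 a b Hf h0.
have E : d1 (d2 f) (s, t) = d2 (d1 f) (s', t').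
  have hn := lt0r_neq0 h0.
  by apply: (mulIf hn); apply: (mulIf hn); exact: etrans (esym Est) Est'.
have H1 := Hu _ (B _ _ u sa tb _); have H2 := Hv _ (B _ _ v sa' tb' _).
have {H1}H1 : `|d1 (d2 f) (a, b) - d1 (d2 f) (s, t)| < e / 2.
  by apply: H1; rewrite ge_min lexx.
have {H2}H2 : `|d2 (d1 f) (a, b) - d2 (d1 f) (s', t')| < e / 2.
  by apply: H2; rewrite ge_min lexx orbT.
rewrite E in H1; move: H1 H2.
move: (d1 (d2 f) (a, b)) (d2 (d1 f) (a, b)) (d2 (d1 f) _) => p q r.
rewrite !ltr_norml => /andP[A1 A2] /andP[B1 B2].
by rewrite ler_norml; apply/andP; split; lra.
Qed.

End Sections.

(** * Integrable functions orthogonal to smooth functions *)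

Section PiLambda.
Local Open Scope ereal_scope.
Context {R : realType} d (T : measurableType d)
  (mu : {measure set T -> \bar R}).

(** The sets whose preimage in [E] carries a zero integral form a Dynkin class.
    The map [p] allows treating one coordinate at a time. *)
Lemma integral_pi_lambda d' (T' : measurableType d') (p : T -> T')
    (C : set (set T')) (E : set T) (G : T -> R) :
  measurable = <<s C >> -> setI_closed C -> measurable_fun setT p ->
  measurable E -> mu.-integrable setT (EFin \o G) ->
  \int[mu]_(x in E) (G x)%:E = 0 ->
  (forall A, C A -> \int[mu]_(x in p @^-1` A `&` E) (G x)%:E = 0) ->
  forall A, measurable A -> \int[mu]_(x in p @^-1` A `&` E) (G x)%:E = 0.
Proof.
move=> mC CI mp mE iG GE GC A mA.
have mpE B : measurable B -> measurable (p @^-1` B `&` E).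
  by move=> mB; apply: measurableI => //; rewrite -[_ @^-1` _]setTI; exact: mp.
have iGS S : measurable S -> mu.-integrable S (EFin \o G).
  by move=> mS; apply: (integrableS measurableT).
pose P : set_system T' := fun A => \int[mu]_(x in p @^-1` A `&` E) (G x)%:E = 0.
apply: (@dynkin_induction _ _ C P) => //; rewrite /P.
- by rewrite preimage_setT setTI.
- move=> S mS S0; have mS' := mpE _ mS; have mSC := mpE _ (measurableC mS).
  have ES : E = (p @^-1` S `&` E) `|` (p @^-1` (~` S) `&` E).
    by rewrite -setIUl -preimage_setU setUCr preimage_setT setTI.
  move: GE; rewrite {1}ES integral_setU_EFin ?S0 ?add0e//.
  + by rewrite -ES; apply/measurable_EFinP/measurable_int/(iGS _ mE).
  + by apply/disj_set2P; rewrite setIACA -preimage_setI setICr preimage_set0 set0I.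
- move=> F mF tF F0; rewrite preimage_bigcup setI_bigcupl integral_bigcup//.
  + by rewrite eseries0// => i _ _; exact: F0.
  + apply/trivIsetP => i j _ _ ij; rewrite setIACA -preimage_setI.
    by move/trivIsetP : tF => /(_ i j I I ij) ->; rewrite preimage_set0 set0I.
  + by move=> k; exact: mpE.
  + by apply: iGS; apply: bigcupT_measurable => k; exact: mpE.
- by rewrite -mC.
Qed.

End PiLambda.

Section Annihilator.
Context {R : realType}.
Local Notation mR := (measurableTypeR R).
Local Notation mplane := (measurableTypeR R * measurableTypeR R)%type.
Implicit Types (f G : plane R -> R) (D E : set (plane R)).

Lemma flat1_gt0 (x : R) : 0 < x -> 0 < flat 1 x.
Proof. by move=> x0; rewrite flat_gt0// hornerC mul1r expR_gt0. Qed.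

Lemma flat1_ge0 (x : R) : 0 <= flat 1 x.
Proof. by have [/flat1_gt0/ltW//|/flat_le0->] := ltP 0 x. Qed.

Lemma flat1_le1 (x : R) : flat 1 x <= 1.
Proof.
have [x0|/flat_le0->//] := ltP 0 x.
by rewrite flat_gt0// hornerC mul1r -expR0 ler_expR oppr_le0 invr_ge0 ltW.
Qed.

(** The uniform bound makes dominated convergence available. *)
Definition smooth_approximable E := exists phi : nat -> plane R -> R,
  [/\ forall n, smooth (phi n), forall n x, 0 <= phi n x <= 1 &
      forall x, phi n x @[n --> \oo] --> (\1_E x : R)].

Lemma smooth_approximableT : smooth_approximable setT.
Proof.
exists (fun _ _ => 1); split=> [n|n x|x]; first exact: smooth_cst.
  by rewrite ler01 lexx.
by rewrite indicT; exact: cvg_cst.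
Qed.

Lemma smooth_approximableI E E' : smooth_approximable E ->
  smooth_approximable E' -> smooth_approximable (E `&` E').
Proof.
move=> [f [sf f01 fE]] [g [sg g01 gE]].
exists (fun n x => f n x * g n x); split=> [n|n x|x]; first exact: smoothM.
  have /andP[f0 f1] := f01 n x; have /andP[g0 g1] := g01 n x.
  by rewrite mulr_ge0//= mulr_ile1.
by rewrite indicI; exact: cvgM.
Qed.

(** The functions [exp(-1/(n t))] increase to 1 for [t > 0] and vanish for
    [t <= 0]. *)
Lemma smooth_approximable_halfplane (a b c : R) :
  smooth_approximable [set x | 0 < aff a b c x].
Proof.
exists (fun n x => flat 1 (aff (n.+1%:R * a) (n.+1%:R * b) (n.+1%:R * c) x)).
have affE n x : aff (n.+1%:R * a) (n.+1%:R * b) (n.+1%:R * c) x =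
    n.+1%:R * aff a b c x by rewrite /aff; ring.
split=> [n|n x|x]; first exact: smooth_flat.
  by rewrite flat1_ge0 flat1_le1.
have [x0|x0] := ltP 0 (aff a b c x); last first.
  rewrite indicE memNset /=; last by apply/negP; rewrite -leNgt.
  apply: cvg_near_cst; apply: nearW => n; rewrite affE flat_le0//.
  by rewrite mulr_ge0_le0.
rewrite indicE mem_set//=.
have -> : (fun n : nat => flat 1 (aff (n.+1%:R * a) (n.+1%:R * b) (n.+1%:R * c) x)) =
    (fun n : nat => expR (- ((aff a b c x)^-1 * n.+1%:R^-1))).
  apply/funext => n; rewrite affE flat_gt0 ?mulr_gt0//.
  by rewrite hornerC mul1r invfM mulrC.
have H : (fun n : nat => - ((aff a b c x)^-1 * n.+1%:R^-1)) @ \oo --> (0 : R).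
  rewrite -oppr0 -(mulr0 (aff a b c x)^-1); apply: cvgN.
  exact: (@cvgM _ _ _ _ (fun=> _) (@harmonic R) _ _ (cvg_cst _) (@cvg_harmonic R)).
rewrite -[X in _ --> X](@expR0 R).
exact: (continuous_cvg _ (@continuous_expR R 0) H).
Qed.

Lemma smooth_measurable f : smooth f -> measurable_fun setT (f : mplane -> R).
Proof. by move=> sf; apply: continuous_meas2; exact: (Ck_continuous (sf 0)). Qed.

Lemma integral_smooth_approximable G E : meas2 E -> smooth_approximable E ->
  leb2.-integrable setT (EFin \o G) ->
  (forall phi, smooth phi -> (\int[leb2]_x (G x * phi x)%:E = 0)%E) ->
  (\int[leb2]_(x in E) (G x)%:E = 0)%E.
Proof.
move=> mE [phi [sphi phi01 phiE]] iG Gphi.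
have mG : measurable_fun setT (G : mplane -> R).
  by apply/measurable_EFinP; exact: measurable_int iG.
have [] := @dominated_convergence _ _ _ (@leb2 R) setT measurableT
  (fun n x => (G x * phi n x)%:E) (fun x => (G x * \1_E x)%:E)
  (fun x => `|G x|%:E).
- move=> n; apply/measurable_EFinP; apply: measurable_funM => //.
  exact: smooth_measurable.
- apply/measurable_EFinP; apply: measurable_funM => //.
- apply: aeW => x _; apply/fine_cvgP; split; first exact: nearW.
  by apply: cvgM; [exact: cvg_cst|exact: phiE].
- exact: integrable_norm iG.
- apply: aeW => x n _; rewrite lee_fin normrM ler_piMr//.
  by have /andP[p0 p1] := phi01 n x; rewrite ger0_norm.
move=> _ _ L.
have {}L : (fun=> 0%E) @ \oo --> (\int[leb2]_x (G x * \1_E x)%:E)%E.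
  rewrite (_ : (fun=> 0%E) = fun n => \int[leb2]_x (G x * phi n x)%:E)%E//.
  by apply/funext => n; rewrite Gphi.
rewrite integral_mkcond; transitivity (\int[leb2]_x (G x * \1_E x)%:E)%E.
  apply: eq_integral => x _; rewrite patchE indicE.
  by case: ifP => _; rewrite ?mulr1 ?mulr0.
by apply/esym/(cvg_unique _ (cvg_cst _) L).
Qed.

(** Half-planes, quadrants and the whole plane are smoothly approximable, so [G]
    has zero integral on them. Passing from rays to Borel sets in one coordinate
    after the other reaches all measurable rectangles, hence all measurable
    sets. *)
Lemma ae_eq0_of_smooth G : leb2.-integrable setT (EFin \o G) ->
  (forall phi, smooth phi -> (\int[leb2]_x (G x * phi x)%:E = 0)%E) ->
  ae_eq leb2 setT (EFin \o G) (cst 0%E).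
Proof.
move=> iG Gphi.
have mG := measurable_int _ iG.
pose ray1 (a : R) : set (plane R) := [set x | 0 < aff (- a) 1 0 x].
pose ray2 (a : R) : set (plane R) := [set x | 0 < aff (- a) 0 1 x].
have ray1E a : fst @^-1` `]a, +oo[%classic = ray1 a.
  apply/seteqP; split => x; rewrite /ray1 /aff /= in_itv/= andbT;
  by rewrite mul1r mul0r addr0 addrC subr_gt0.
have ray2E a : snd @^-1` `]a, +oo[%classic = ray2 a.
  apply/seteqP; split => x; rewrite /ray2 /aff /= in_itv/= andbT;
  by rewrite mul1r mul0r addr0 addrC subr_gt0.
have mR1 (A : set mR) : measurable A -> meas2 (fst @^-1` A).
  by move=> mA; rewrite -[_ @^-1` _]setTI; exact: measurable_fst.
have mR2 (A : set mR) : measurable A -> meas2 (snd @^-1` A).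
  by move=> mA; rewrite -[_ @^-1` _]setTI; exact: measurable_snd.
have raysE : @measurable _ mR = <<s @measurable_realfun.RGenOInfty.G R >> :=
  measurable_realfun.RGenOInfty.measurableE R.
have raysI : setI_closed (@measurable_realfun.RGenOInfty.G R).
  move=> _ _ [a ->] [b ->]; exists (Num.max a b); apply/seteqP.
  by split=> x /=; rewrite !in_itv /= !andbT gt_max => /andP.
pose Z := integral_smooth_approximable _ _ iG Gphi.
have I1 a (A : set mR) : measurable A ->
    (\int[leb2]_(x in fst @^-1` A `&` ray2 a) (G x)%:E = 0)%E.
  apply: (@integral_pi_lambda _ _ mplane leb2 _ mR fst _ (ray2 a) G raysE) => //.
  - by rewrite -ray2E; apply: mR2; exact: measurable_itv.
  - apply: Z; last exact: smooth_approximable_halfplane.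
    by rewrite -ray2E; apply: mR2; exact: measurable_itv.
  - move=> _ [b ->]; apply: Z.
      apply: measurableI; first by apply: mR1; exact: measurable_itv.
      by rewrite -ray2E; apply: mR2; exact: measurable_itv.
    by rewrite ray1E; apply: smooth_approximableI; exact: smooth_approximable_halfplane.
have I1T (A : set mR) : measurable A ->
    (\int[leb2]_(x in fst @^-1` A) (G x)%:E = 0)%E.
  move=> mA; rewrite -[_ @^-1` _]setIT.
  apply: (@integral_pi_lambda _ _ mplane leb2 _ mR fst _ setT G raysE) => //.
  - by apply: Z; [exact: measurableT|exact: smooth_approximableT].
  - move=> _ [b ->]; rewrite setIT; apply: Z.
      by apply: mR1; exact: measurable_itv.
    by rewrite ray1E; exact: smooth_approximable_halfplane.
have I2 (A B : set mR) : measurable A -> measurable B ->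
    (\int[leb2]_(x in snd @^-1` B `&` fst @^-1` A) (G x)%:E = 0)%E.
  move=> mA; apply: (@integral_pi_lambda _ _ mplane leb2 _ mR snd _ (fst @^-1` A) G raysE) => //.
  - exact: mR1.
  - exact: I1T.
  - by move=> _ [b ->]; rewrite ray2E setIC; exact: I1.
have I3 (S : set mplane) : measurable S -> (\int[leb2]_(x in S) (G x)%:E = 0)%E.
  move=> mS; rewrite -[S]setIT -[S in S `&` _]preimage_id.
  apply: (@integral_pi_lambda _ _ mplane leb2 _ mplane id _ setT G
    (@measurable_prod_measurableType _ _ mR mR)) => //.
  - move=> _ _ [A mA [B mB <-]] [A' mA' [B' mB' <-]].
    exists (A `&` A'); first exact: measurableI.
    by exists (B `&` B'); [exact: measurableI|rewrite setXI].
  - by apply: Z; [exact: measurableT|exact: smooth_approximableT].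
  - move=> _ [A mA [B mB <-]]; rewrite setIT preimage_id.
    by rewrite (_ : A `*` B = snd @^-1` B `&` fst @^-1` A) ?I2// setIC.
apply: integral_ae_eq => //.
by move=> E _ mE; rewrite integral0; exact: I3.
Qed.
End Annihilator.

(** * The fundamental lemma of the calculus of variations *)

Section Fundamental.
Context {R : realType}.
Local Notation mR := (measurableTypeR R).
Local Notation mplane := (measurableTypeR R * measurableTypeR R)%type.
Implicit Types (f g phi : plane R -> R) (D : set (plane R)).

Lemma compactly_supported_bounded D phi : continuous phi ->
  compactly_supported D phi -> [bounded phi x | x in setT].
Proof.
move=> cphi [K [cK _ phi0]].
have : bounded_set (phi @` K).
  apply: compact_bounded; apply: continuous_compact => //.
  exact: continuous_subspaceT.
move=> [M [Mr fM]]; exists (Num.max M 0); split; first exact: num_real.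
move=> x; rewrite gt_max => /andP[Mx x0] y _.
have [Ky|nKy] := pselect (K y); first by apply: (fM x Mx); exists y.
by rewrite /= phi0// normr0 ltW.
Qed.

Lemma integrableM_bounded D f h : meas2 D ->
  leb2.-integrable D (EFin \o f) -> measurable_fun D (h : mplane -> R) ->
  [bounded h x | x in D] -> leb2.-integrable D (EFin \o (fun x => f x * h x)).
Proof. by move=> mD iF mh bh; exact: (integrableMl mD iF mh bh). Qed.

Lemma compactly_supportedMr D phi f : compactly_supported D phi ->
  compactly_supported D (fun x => phi x * f x).
Proof.
move=> [K [cK KD phi0]]; exists K; split=> // x /phi0 ->; exact: mul0r.
Qed.

Definition rect_bump (a b c d : R) (x : plane R) : R :=
  flat 1 (aff (- a) 1 0 x) * flat 1 (aff b (-1) 0 x) *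
  (flat 1 (aff (- c) 0 1 x) * flat 1 (aff d 0 (-1) x)).

Lemma smooth_rect_bump a b c d : smooth (rect_bump a b c d).
Proof. by do 2 apply: smoothM; exact: smooth_flat. Qed.

Lemma rect_bump_gt0 a b c d x :
  (`]a, b[%classic `*` `]c, d[%classic) x -> 0 < rect_bump a b c d x.
Proof.
rewrite /rect_bump /aff => -[/=]; rewrite !in_itv/= => /andP[xa xb] /andP[xc xd].
by rewrite !mulr_gt0//; apply: flat1_gt0; lra.
Qed.

Lemma rect_bump_support a b c d x : rect_bump a b c d x != 0 ->
  (`[a, b]%classic `*` `[c, d]%classic) x.
Proof.
have pos t : flat 1 t != 0 -> 0 < t.
  by move=> ft; rewrite ltNge; apply: contra ft => t0; rewrite flat_le0.
rewrite /rect_bump !mulf_eq0 !negb_or => /andP[/andP[/pos xa /pos xb] /andP[/pos xc /pos xd]].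
move: xa xb xc xd; rewrite /aff => xa xb xc xd.
by split=> /=; rewrite in_itv /=; apply/andP; split; lra.
Qed.

Lemma rect_bump_compactly_supported D a b c d :
  `[a, b]%classic `*` `[c, d]%classic `<=` D ->
  compactly_supported D (rect_bump a b c d).
Proof.
move=> sub; exists (`[a, b]%classic `*` `[c, d]%classic); split=> //.
  exact: compact_rect.
move=> x nx; apply/eqP/negPn/negP; move/rect_bump_support; exact: nx.
Qed.

(** On each rectangle of a countable cover, the product of a smooth function with
    a bump positive exactly there is a test function. So [f] times the bump is
    orthogonal to all smooth functions, hence zero almost everywhere. *)
Lemma ae_eq0_of_test D f : open D -> leb2.-integrable D (EFin \o f) ->
  (forall phi, smooth phi -> compactly_supported D phi ->
     int2 D (fun x => f x * phi x) = 0) ->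
  {ae leb2, forall x, D x -> f x = 0}.
Proof.
move=> oD iF fphi; have mD := open_meas2 oD.
have [a [b [c [d [sub sup]]]]] := open_rect_cover oD.
pose chi n := rect_bump (a n) (b n) (c n) (d n).
have schi n : smooth (chi n) by exact: smooth_rect_bump.
have cchi n : compactly_supported D (chi n).
  exact: rect_bump_compactly_supported.
have iFphi phi : smooth phi -> compactly_supported D phi ->
    leb2.-integrable D (EFin \o (fun x => f x * phi x)).
  move=> sphi cphi; apply: integrableM_bounded => //.
    by apply: measurable_funTS; exact: smooth_measurable.
  have [M [Mr HM]] := compactly_supported_bounded (Ck_continuous (sphi 0)) cphi.
  by exists M; split => // x Mx y _; exact: (HM x Mx y).
have H n : {ae leb2, forall x, D x -> f x * chi n x = 0}.
  have : ae_eq leb2 setT (EFin \o ((fun x => f x * chi n x) \_ D)) (cst 0%E).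
    apply: ae_eq0_of_smooth.
      rewrite -restrict_EFin.
      by apply: (integrable_mkcond _ mD).1; exact: (iFphi _ (schi n) (cchi n)).
    move=> phi sphi.
    have sp : smooth (fun x => chi n x * phi x) by exact: smoothM.
    have cp : compactly_supported D (fun x => chi n x * phi x).
      exact: compactly_supportedMr.
    transitivity (\int[leb2]_(x in D) (f x * (chi n x * phi x))%:E)%E.
      rewrite [RHS]integral_mkcond; apply: eq_integral => x _.
      by rewrite !patchE; case: ifP => _; rewrite ?mul0r// mulrA.
    have := fphi _ sp cp; rewrite /int2 /Rintegral => I0.
    have := integrable_fin_num mD (iFphi _ sp cp) => /fineK <-.
    by congr (_%:E).
  move=> [N [mN N0 sN]]; exists N; split=> // x /= nx; apply: sN => /= h.
  apply: nx => Dx; have := h I; rewrite /= patchE mem_set//.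
  by move=> [].
have [N [mN N0 sN]] : leb2.-negligible
    (\bigcup_n [set x | ~ (D x -> f x * chi n x = 0)]).
  by apply: negligible_bigcup => n; exact: H.
exists N; split=> // x /= nx; apply: sN.
have Dx : D x by apply: contrapT => nD; apply: nx => /nD.
have [n _ xn] := sup _ Dx; exists n => //= h; apply: nx => _.
have /eqP := h Dx; rewrite mulf_eq0 => /orP[/eqP//|/eqP chi0].
by have := rect_bump_gt0 xn; rewrite -/(chi n x) chi0 ltxx.
Qed.

End Fundamental.

(** * Integrals of derivatives *)

Section Green.
Context {R : realType}.
Local Notation mR := (measurableTypeR R).
Local Notation mplane := (measurableTypeR R * measurableTypeR R)%type.
Implicit Types (f g phi : plane R -> R) (D : set (plane R)).

Lemma int2_support D E g : D `<=` E -> (forall x, E x -> ~ D x -> g x = 0) ->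
  int2 D g = int2 E g.
Proof.
move=> DE g0; rewrite /int2 Rintegral_mkcond [RHS]Rintegral_mkcond.
congr Rintegral; apply/funext => x; rewrite !patchE.
case: ifPn => xD; first by rewrite mem_set//; exact/DE/set_mem.
case: ifPn => // xE; rewrite g0//; first exact: set_mem.
by move: xD; rewrite notin_setE.
Qed.

Lemma compactly_supported_rect D phi : compactly_supported D phi ->
  exists2 M, 0 < M & forall x y, phi (x, y) != 0 -> `|x| < M /\ `|y| < M.
Proof.
move=> [K [cK _ phi0]].
have /bounded_subset_rect[M KM] := compact_bounded cK.
exists (`|M| + 1); first by rewrite ltr_wpDl.
move=> x y pxy; have Kxy : K (x, y).
  by apply: contrapT => /phi0 h; move: pxy; rewrite h eqxx.
have [/=] := KM _ Kxy; rewrite !in_itv/= -!ler_norml => xM yM.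
have MM := ler_norm M.
by split; [apply: (le_lt_trans xM)|apply: (le_lt_trans yM)]; lra.
Qed.

Lemma test_integrable D E phi : meas2 E -> continuous phi ->
  compactly_supported D phi -> leb2.-integrable E (EFin \o phi).
Proof.
move=> mE cphi sphi; apply: (integrableS measurableT) => //.
have [M M0 HM] := compactly_supported_rect sphi.
pose S : set (plane R) := `[- M, M]%classic `*` `[- M, M]%classic.
have mS : meas2 S by apply: measurableX; exact: measurable_itv.
have : leb2.-integrable S (EFin \o phi).
  apply: measurable_bounded_integrable => //.
  - exact: leb2_rect.
  - by apply: measurable_funTS; exact: continuous_meas2.
  have [B [Br HB]] := compactly_supported_bounded cphi sphi.
  by exists B; split => // x Mx y _; exact: (HB x Mx y).
move=> /(integrable_mkcond _ mS).1; apply: eq_integrable => // -[x y] _.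
rewrite /= patchE; case: ifPn => //; rewrite notin_setE => nS.
congr (_%:E); apply/esym/eqP/negPn/negP => /HM[xM yM]; apply: nS.
by split; rewrite /= in_itv/= -ler_norml ltW.
Qed.

Lemma compactly_supported_near0 K phi x : compact K ->
  (forall x, ~ K x -> phi x = 0) -> ~ K x -> \near x, cst 0 x = phi x.
Proof.
move=> cK phi0 nKx.
have oK : open (~` K).
  by apply: closed_openC; apply: compact_closed => //; exact: norm_hausdorff.
have : nbhs x (~` K) by apply: open_nbhs_nbhs.
by apply: filterS => y nKy; rewrite phi0.
Qed.

Lemma compactly_supported_d1 D phi : compactly_supported D phi ->
  compactly_supported D (d1 phi).
Proof.
move=> [K [cK KD phi0]]; exists K; split=> // x nKx.
rewrite /d1 -(near_eq_derive ((1, 0) : plane R) (compactly_supported_near0 cK phi0 nKx)).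
exact: derive_cst.
Qed.

Lemma compactly_supported_d2 D phi : compactly_supported D phi ->
  compactly_supported D (d2 phi).
Proof.
move=> [K [cK KD phi0]]; exists K; split=> // x nKx.
rewrite /d2 -(near_eq_derive ((0, 1) : plane R) (compactly_supported_near0 cK phi0 nKx)).
exact: derive_cst.
Qed.

Lemma integral_derivative_eq0 (F f : R -> R) (M : R) : 0 < M ->
  continuous f -> (forall x, is_derive x (1 : R) F (f x)) ->
  (forall x, M <= `|x| -> F x = 0) -> (forall x, M <= `|x| -> f x = 0) ->
  (\int[lebesgue_measure]_x (f x)%:E = 0)%E.
Proof.
move=> M0 cf dF F0 f0.
transitivity (\int[lebesgue_measure]_(x in `[(- M)%R, M]) (f x)%:E)%E.
  rewrite [RHS]integral_mkcond; apply: eq_integral => x _; rewrite patchE.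
  case: ifPn => //; rewrite notin_setE /= in_itv/= => /negP.
  by rewrite -ler_norml -ltNge => /ltW /f0 ->.
have cF : continuous F.
  move=> x; apply: differentiable_continuous; apply/derivable1_diffP.
  by have [] := dF x.
rewrite (@continuous_FTC2 _ f F); first last.
- by move=> x _; rewrite derive1E; have [_ ->] := dF x.
- split=> [x _|//|//]; first by have [] := dF x.
    exact/cvg_at_right_filter/cF.
  exact/cvg_at_left_filter/cF.
- exact: continuous_subspaceT.
- lra.
by rewrite !F0 ?normrN ?ger0_norm ?(ltW M0)// subee.
Qed.

(** Fubini, and the fundamental theorem of calculus on every horizontal line. *)
Lemma int_d1_eq0 D phi : Ck 1 phi -> compactly_supported D phi ->
  int2 setT (d1 phi) = 0.
Proof.
move=> [cphi [df1 df2 [c1 _] [c2 _]]] sphi.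
have [M M0 HM] := compactly_supported_rect sphi.
have [M' M'0 HM'] := compactly_supported_rect (compactly_supported_d1 sphi).
have iF := test_integrable measurableT c1 (compactly_supported_d1 sphi).
rewrite /int2 /Rintegral -(integral21_prod_meas1 iF).
rewrite integral0_eq//= => t _.
apply: (@integral_derivative_eq0 (fun u => phi (u, t)) _ (Num.max M M')).
- by rewrite lt_max M0.
- move=> x; apply: (@continuous_comp _ _ _ (fun u => (u, t)) (d1 phi)).
    exact: (cvg_pair (G := nbhs x) (H := nbhs t) (f := id) (g := cst t) cvg_id (cvg_cst t)).
  exact: c1.
- by move=> x; exact: (is_derive_slice1 (df1 (x, t))).
- move=> x; rewrite ge_max => /andP[Mx _]; apply/eqP/negPn/negP => /HM[].
  by rewrite ltNge Mx.
- move=> x; rewrite ge_max => /andP[_ Mx]; apply/eqP/negPn/negP => /HM'[].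
  by rewrite ltNge Mx.
Qed.

Lemma int_d2_eq0 D phi : Ck 1 phi -> compactly_supported D phi ->
  int2 setT (d2 phi) = 0.
Proof.
move=> [cphi [df1 df2 [c1 _] [c2 _]]] sphi.
have [M M0 HM] := compactly_supported_rect sphi.
have [M' M'0 HM'] := compactly_supported_rect (compactly_supported_d2 sphi).
have iF := test_integrable measurableT c2 (compactly_supported_d2 sphi).
rewrite /int2 /Rintegral -(integral12_prod_meas1 iF).
rewrite integral0_eq//= => t _.
apply: (@integral_derivative_eq0 (fun u => phi (t, u)) _ (Num.max M M')).
- by rewrite lt_max M0.
- move=> x; apply: (@continuous_comp _ _ _ (fun u => (t, u)) (d2 phi)).
    exact: (cvg_pair (G := nbhs t) (H := nbhs x) (f := cst t) (g := id) (cvg_cst t) cvg_id).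
  exact: c2.
- by move=> x; exact: (is_derive_slice2 (df2 (t, x))).
- move=> x; rewrite ge_max => /andP[Mx _]; apply/eqP/negPn/negP => /HM[_].
  by rewrite ltNge Mx.
- move=> x; rewrite ge_max => /andP[_ Mx]; apply/eqP/negPn/negP => /HM'[_].
  by rewrite ltNge Mx.
Qed.

End Green.

(** * Square integrable functions, weak curl and weak divergence *)

Section WeakDerivatives.
Context {R : realType}.
Local Notation mR := (measurableTypeR R).
Local Notation mplane := (measurableTypeR R * measurableTypeR R)%type.
Implicit Types (f g r : plane R -> R) (q c : plane R -> plane R).
Implicit Types (phi : plane R -> plane R) (psi : plane R -> R) (D E : set (plane R)).

Lemma L2_measurable D f : L2 D f -> measurable_fun D (f : mplane -> R).
Proof. by case. Qed.

Lemma L2S D E f : meas2 D -> meas2 E -> E `<=` D -> L2 D f -> L2 E f.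
Proof.
move=> mD mE ED [mf iF]; split; last exact: integrableS iF.
exact: measurable_funS ED mf.
Qed.

(** The bound fits both products and squares of differences. *)
Lemma L2_le D f g h : measurable_fun D (h : mplane -> R) -> meas2 D -> L2 D f -> L2 D g ->
  (forall x, D x -> `|h x| <= f x ^+ 2 *+ 2 + g x ^+ 2 *+ 2) ->
  leb2.-integrable D (EFin \o h).
Proof.
move=> mh mD [mf iF] [mg ig] hfg.
have i2 : leb2.-integrable D (EFin \o (fun x => 2 * f x ^+ 2 + 2 * g x ^+ 2)).
  exact: (integrableD mD (integrableZl mD 2 iF) (integrableZl mD 2 ig)).
apply: le_integrable i2 => //.
  exact/measurable_EFinP.
move=> x Dx /=; rewrite lee_fin [leRHS]ger0_norm; last first.
  by rewrite addr_ge0// mulr_ge0// sqr_ge0.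
by rewrite !mulr_natl; exact: hfg.
Qed.

Lemma L2M D f g : meas2 D -> L2 D f -> L2 D g ->
  leb2.-integrable D (EFin \o (fun x => f x * g x)).
Proof.
move=> mD Lf Lg; apply: (L2_le _ mD Lf Lg).
  by apply: measurable_funM; exact: L2_measurable.
move=> x _; rewrite normrM -(real_normK (num_real (f x))).
rewrite -(real_normK (num_real (g x))).
have := sqr_ge0 (`|f x| - `|g x|); have := normr_ge0 (f x).
have := normr_ge0 (g x); nra.
Qed.

Lemma L2B D f g : meas2 D -> L2 D f -> L2 D g -> L2 D (fun x => f x - g x).
Proof.
move=> mD Lf Lg; have mfg : measurable_fun D ((fun x => f x - g x) : mplane -> R).
  by apply: measurable_funB; exact: L2_measurable.
split=> //; apply: (L2_le _ mD Lf Lg).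
  by apply: measurable_funX.
move=> x _; rewrite ger0_norm ?sqr_ge0//.
by have := sqr_ge0 (f x + g x); nra.
Qed.

Lemma L2_bounded D f : meas2 D -> (leb2 D < +oo)%E ->
  measurable_fun D (f : mplane -> R) -> [bounded f x | x in D] -> L2 D f.
Proof.
move=> mD fD mf [M [Mr HM]]; split=> //.
apply: measurable_bounded_integrable => //; first exact: measurable_funX.
exists ((`|M| + 1) ^+ 2); split; first exact: num_real.
move=> x Mx y Dy; rewrite /= normrX; apply: le_trans (ltW Mx).
rewrite lerXn2r ?nnegrE ?addr_ge0//; apply: HM => //.
by rewrite (le_lt_trans (ler_norm M))// ltrDl.
Qed.

Lemma L2_cst D a : meas2 D -> (leb2 D < +oo)%E -> L2 D (fun=> a).
Proof.
move=> mD fD; apply: L2_bounded => //.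
by exists `|a|; split => // x ax y _; exact: ltW.
Qed.

Lemma L2_integrable D f : meas2 D -> (leb2 D < +oo)%E -> L2 D f ->
  leb2.-integrable D (EFin \o f).
Proof.
move=> mD fD Lf; have := L2M mD Lf (L2_cst 1 mD fD).
by apply: eq_integrable => // x _ /=; rewrite mulr1.
Qed.

Lemma L2M_continuous D f psi : meas2 D -> bounded_set D -> L2 D f ->
  continuous psi -> leb2.-integrable D (EFin \o (fun x => f x * psi x)).
Proof.
move=> mD bD Lf cpsi; apply: integrableM_bounded => //.
- by apply: L2_integrable => //; exact: bounded_leb2_lty.
- by apply: measurable_funTS; exact: continuous_meas2.
- exact: continuous_bounded.
Qed.

Lemma int2_ae D f g : meas2 D -> measurable_fun D (f : mplane -> R) ->
  measurable_fun D (g : mplane -> R) ->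
  {ae leb2, forall x, D x -> f x = g x} -> int2 D f = int2 D g.
Proof.
move=> mD mf mg fg; rewrite /int2 /Rintegral; congr fine.
apply: ae_eq_integral => //; [exact/measurable_EFinP|exact/measurable_EFinP|].
by move: fg; apply: filterS => x /= h Dx; rewrite h.
Qed.

Lemma int2_eq D f g : (forall x, D x -> f x = g x) -> int2 D f = int2 D g.
Proof. by move=> fg; apply: eq_Rintegral => x /set_mem; exact: fg. Qed.

Lemma int2B D f g : meas2 D -> leb2.-integrable D (EFin \o f) ->
  leb2.-integrable D (EFin \o g) ->
  int2 D (fun x => f x - g x) = int2 D f - int2 D g.
Proof. by move=> mD iF ig; exact: RintegralB. Qed.

Lemma int2D D f g : meas2 D -> leb2.-integrable D (EFin \o f) ->
  leb2.-integrable D (EFin \o g) ->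
  int2 D (fun x => f x + g x) = int2 D f + int2 D g.
Proof. by move=> mD iF ig; exact: RintegralD. Qed.

Lemma int2Zl D a f : meas2 D -> leb2.-integrable D (EFin \o f) ->
  int2 D (fun x => a * f x) = a * int2 D f.
Proof. by move=> mD iF; exact: RintegralZl. Qed.

Lemma measurable_dot D (c q : plane R -> plane R) :
  measurable_fun D ((fun x => (c x).1) : mplane -> R) ->
  measurable_fun D ((fun x => (c x).2) : mplane -> R) ->
  measurable_fun D ((fun x => (q x).1) : mplane -> R) ->
  measurable_fun D ((fun x => (q x).2) : mplane -> R) ->
  measurable_fun D ((fun x => dot (c x) (q x)) : mplane -> R).
Proof. by move=> *; apply: measurable_funD; apply: measurable_funM. Qed.

Lemma integrable_dot D c q : meas2 D -> L2v D c -> L2v D q ->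
  leb2.-integrable D (EFin \o (fun x => dot (c x) (q x))).
Proof.
move=> mD [c1 c2] [q1 q2].
exact: (integrableD mD (L2M mD c1 q1) (L2M mD c2 q2)).
Qed.

Lemma integrable_dot_continuous D c phi : meas2 D -> bounded_set D -> L2v D c ->
  smoothv phi -> leb2.-integrable D (EFin \o (fun x => dot (c x) (phi x))).
Proof.
move=> mD bD [c1 c2] [p1 p2].
exact: (integrableD mD (L2M_continuous mD bD c1 (Ck_continuous (p1 0)))
                       (L2M_continuous mD bD c2 (Ck_continuous (p2 0)))).
Qed.

Lemma smoothB f g : smooth f -> smooth g -> smooth (fun x => f x - g x).
Proof.
move=> sf sg k.
have : Ck k (fun x => f x + -1 * g x) by apply: CkD => //; apply: CkM => //; exact: Ck_cst.
by congr Ck; apply/funext => x; rewrite mulN1r.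
Qed.

Lemma smooth_ccurl phi : smoothv phi -> smooth (ccurl phi).
Proof. by move=> [p1 p2]; apply: smoothB; [exact: smooth_d1|exact: smooth_d2]. Qed.

Lemma smooth_cgrad psi : smooth psi -> smoothv (cgrad psi).
Proof. by move=> sp; split; [exact: smooth_d1|exact: smooth_d2]. Qed.

Lemma ccurl_cgrad psi : smooth psi -> ccurl (cgrad psi) = fun=> 0.
Proof.
move=> sp; apply/funext => x; apply/eqP; rewrite subr_eq0; apply/eqP.
exact: (congr1 (fun f => f x) (schwarz (sp 2%N))).
Qed.

Lemma L20 D : meas2 D -> L2 D (fun=> 0).
Proof.
move=> mD; split; first exact: measurable_cst.
rewrite (_ : _ \o _ = cst 0%E); first exact: integrable0.
by apply/funext => x /=; rewrite expr0n.
Qed.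

Lemma L2v0 D : meas2 D -> L2v D (fun=> 0).
Proof. by move=> mD; split; exact: L20. Qed.

Lemma L2_test D psi : meas2 D -> (leb2 D < +oo)%E -> smooth psi ->
  compactly_supported D psi -> L2 D psi.
Proof.
move=> mD fD sp cp; apply: L2_bounded => //.
  by apply: measurable_funTS; exact: smooth_measurable.
have [M [Mr HM]] := compactly_supported_bounded (Ck_continuous (sp 0)) cp.
by exists M; split => // x Mx y _; exact: (HM x Mx y).
Qed.

(** The two components are separated by test fields with one zero component. *)
Lemma is_curl_unique D r c c' : open D -> (leb2 D < +oo)%E ->
  is_curl D r c -> is_curl D r c' -> {ae leb2, forall x, D x -> c x = c' x}.
Proof.
move=> oD fD [Lc Hc] [Lc' Hc']; have mD := open_meas2 oD.
have [c1 c2] := Lc; have [c1' c2'] := Lc'.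
have L1 := L2B mD c1 c1'; have L2' := L2B mD c2 c2'.
have A1 : {ae leb2, forall x, D x -> (c x).1 - (c' x).1 = 0}.
  apply: ae_eq0_of_test => //; first exact: L2_integrable.
  move=> p sp cp; have Lp := L2_test mD fD sp cp.
  have sv : smoothv (fun x => (p x, 0)) by split => //; exact: smooth_cst.
  have cv : compactly_supported D (fun x => (p x, 0) : plane R).
    by have [S [cS SD p0]] := cp; exists S; split=> // x /p0 ->.
  have E w : (fun x => dot (w x) (p x, 0)) = (fun x => (w x).1 * p x).
    by apply/funext => x; rewrite /dot /= mulr0 addr0.
  rewrite (@int2_eq _ _ (fun x => (c x).1 * p x - (c' x).1 * p x)); last first.
    by move=> x _; rewrite mulrBl.
  rewrite int2B//; [|exact: L2M|exact: L2M].
  by rewrite -!E -Hc// -Hc'// subrr.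
have A2 : {ae leb2, forall x, D x -> (c x).2 - (c' x).2 = 0}.
  apply: ae_eq0_of_test => //; first exact: L2_integrable.
  move=> p sp cp; have Lp := L2_test mD fD sp cp.
  have sv : smoothv (fun x => (0, p x)) by split => //; exact: smooth_cst.
  have cv : compactly_supported D (fun x => (0, p x) : plane R).
    by have [S [cS SD p0]] := cp; exists S; split=> // x /p0 ->.
  have E w : (fun x => dot (w x) (0, p x)) = (fun x => (w x).2 * p x).
    by apply/funext => x; rewrite /dot /= mulr0 add0r.
  rewrite (@int2_eq _ _ (fun x => (c x).2 * p x - (c' x).2 * p x)); last first.
    by move=> x _; rewrite mulrBl.
  rewrite int2B//; [|exact: L2M|exact: L2M].
  by rewrite -!E -Hc// -Hc'// subrr.
apply: filterS2 A1 A2 => x e1 e2 Dx.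
move/subr0_eq : (e1 Dx) => {}e1; move/subr0_eq : (e2 Dx) => {}e2.
by rewrite [c x]surjective_pairing e1 e2 -surjective_pairing.
Qed.

Lemma is_div_unique D q s s' : open D -> (leb2 D < +oo)%E ->
  is_div D q s -> is_div D q s' -> {ae leb2, forall x, D x -> s x = s' x}.
Proof.
move=> oD fD [Ls Hs] [Ls' Hs']; have mD := open_meas2 oD.
have A : {ae leb2, forall x, D x -> s x - s' x = 0}.
  apply: ae_eq0_of_test => //; first by apply: L2_integrable => //; exact: L2B.
  move=> p sp cp; have Lp := L2_test mD fD sp cp.
  rewrite (@int2_eq _ _ (fun x => s x * p x - s' x * p x)); last first.
    by move=> x _; rewrite mulrBl.
  rewrite int2B//; [|exact: L2M|exact: L2M].
  by apply/eqP; rewrite subr_eq0 -eqr_opp -Hs// -Hs'.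
by apply: filterS A => x e Dx; exact: subr0_eq (e Dx).
Qed.

Lemma curlP D r : Hcurl D r -> is_curl D r (curl D r).
Proof. by move=> [_ H]; exact: xgetPex. Qed.

Lemma curl_ae D r c : open D -> (leb2 D < +oo)%E -> is_curl D r c ->
  {ae leb2, forall x, D x -> curl D r x = c x}.
Proof.
move=> oD fD Hc; apply: (is_curl_unique oD fD _ Hc).
by apply: xgetPex; exists c.
Qed.

Lemma div_ae D q s : open D -> (leb2 D < +oo)%E -> is_div D q s ->
  {ae leb2, forall x, D x -> div D q x = s x}.
Proof.
move=> oD fD Hs; apply: (is_div_unique oD fD _ Hs).
by apply: xgetPex; exists s.
Qed.

(** A test field on the smaller set is one on the larger set, and both integrands
    vanish in between. *)
Lemma is_curlS D E r c : meas2 D -> meas2 E -> E `<=` D ->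
  is_curl D r c -> is_curl E r c.
Proof.
move=> mD mE ED [[c1 c2] Hc]; split.
  by split; exact: L2S ED _.
move=> phi sp cp; have [K [cK KE p0]] := cp.
have cD : compactly_supported D phi by exists K; split=> //; exact: subset_trans ED.
have near0 x : ~ E x -> phi x = 0 by move=> nE; apply: p0 => /KE.
have cu0 x : ~ E x -> ccurl phi x = 0.
  move=> nE; have nK : ~ K x by move/KE.
  have s1 : forall y, ~ K y -> (phi y).1 = 0 by move=> y /p0 ->.
  have s2 : forall y, ~ K y -> (phi y).2 = 0 by move=> y /p0 ->.
  rewrite /ccurl /d1 /d2.
  rewrite -(near_eq_derive ((1, 0) : plane R) (compactly_supported_near0 cK s2 nK)).
  rewrite -(near_eq_derive ((0, 1) : plane R) (compactly_supported_near0 cK s1 nK)).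
  by rewrite !derive_cst subrr.
rewrite (@int2_support _ E D)//; last by move=> x _ /cu0 ->; rewrite mulr0.
rewrite [RHS](@int2_support _ E D)//; last first.
  by move=> x _ /near0 ->; rewrite /dot !mulr0 addr0.
exact: Hc.
Qed.

Lemma is_curlB D r r' c c' : meas2 D -> bounded_set D -> L2 D r -> L2 D r' ->
  is_curl D r c -> is_curl D r' c' ->
  is_curl D (fun x => r x - r' x) (fun x => c x - c' x).
Proof.
move=> mD bD Lr Lr' [[c1 c2] Hc] [[c1' c2'] Hc']; split.
  by split; exact: L2B.
move=> phi sp cp.
have ccu := Ck_continuous (smooth_ccurl sp 0).
rewrite (@int2_eq _ _ (fun x => r x * ccurl phi x - r' x * ccurl phi x)); last first.
  by move=> x _; rewrite mulrBl.
rewrite int2B//; [|exact: L2M_continuous|exact: L2M_continuous].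
rewrite Hc// Hc'// -int2B//; [|exact: integrable_dot_continuous|exact: integrable_dot_continuous].
by apply: int2_eq => x _; rewrite /dot /=; ring.
Qed.

(** Integration by parts: the products of the affine function with the components
    of the test field have derivatives of zero integral. *)
Lemma is_curl_aff D (a b c : R) : open D -> (leb2 D < +oo)%E ->
  is_curl D (aff a b c) (fun=> (c, - b)).
Proof.
move=> oD fD; have mD := open_meas2 oD; split; first by split; exact: L2_cst.
move=> phi [s1 s2] cp; have [K [cK KD p0]] := cp.
have c1 : compactly_supported D (fun x => (phi x).1).
  by exists K; split=> // x /p0 ->.
have c2 : compactly_supported D (fun x => (phi x).2).
  by exists K; split=> // x /p0 ->.
have sa := smooth_aff a b c.
have sm1 : smooth (fun x => (phi x).1 * aff a b c x) by exact: smoothM.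
have sm2 : smooth (fun x => (phi x).2 * aff a b c x) by exact: smoothM.
have cm1 := compactly_supportedMr (aff a b c) c1.
have cm2 := compactly_supportedMr (aff a b c) c2.
have da x v := is_derive_aff_comp v (is_derive_id (aff a b c x) (1 : R)).
have E2 x : d1 (fun x => (phi x).2 * aff a b c x) x =
    aff a b c x * d1 (fun x => (phi x).2) x + b * (phi x).2.
  have [_ [p _ _ _]] := s2 1%N; have [ad aE] := da x (1, 0).
  have aE1 : 'D_(1, 0) (aff a b c) x = b by rewrite aE /= mulr1 mulr0 addr0 mul1r.
  have -> : d1 (fun x => (phi x).2 * aff a b c x) x =
      (phi x).2 *: 'D_(1, 0) (aff a b c) x +
      aff a b c x *: 'D_(1, 0) (fun x => (phi x).2) x.
    exact: (deriveM (p x) ad).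
  by rewrite aE1 addrC /GRing.scale /= [(phi x).2 * b]mulrC.
have E1 x : d2 (fun x => (phi x).1 * aff a b c x) x =
    aff a b c x * d2 (fun x => (phi x).1) x + c * (phi x).1.
  have [_ [_ p _ _]] := s1 1%N; have [ad aE] := da x (0, 1).
  have aE1 : 'D_(0, 1) (aff a b c) x = c by rewrite aE /= mulr1 mulr0 add0r mul1r.
  have -> : d2 (fun x => (phi x).1 * aff a b c x) x =
      (phi x).1 *: 'D_(0, 1) (aff a b c) x +
      aff a b c x *: 'D_(0, 1) (fun x => (phi x).1) x.
    exact: (deriveM (p x) ad).
  by rewrite aE1 addrC /GRing.scale /= [(phi x).1 * c]mulrC.
have Z2 : int2 D (d1 (fun x => (phi x).2 * aff a b c x)) = 0.
  have [S [cS SD q0]] := compactly_supported_d1 cm2.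
  rewrite (int2_support (@subsetT _ D)); last first.
    by move=> x _ nD; apply: q0 => /SD.
  exact: (int_d1_eq0 (sm2 1%N) cm2).
have Z1 : int2 D (d2 (fun x => (phi x).1 * aff a b c x)) = 0.
  have [S [cS SD q0]] := compactly_supported_d2 cm1.
  rewrite (int2_support (@subsetT _ D)); last first.
    by move=> x _ nD; apply: q0 => /SD.
  exact: (int_d2_eq0 (sm1 1%N) cm1).
have i2 := test_integrable mD (Ck_continuous (smooth_d1 sm2 0)) (compactly_supported_d1 cm2).
have i1 := test_integrable mD (Ck_continuous (smooth_d2 sm1 0)) (compactly_supported_d2 cm1).
have j1 := test_integrable mD (Ck_continuous (s1 0)) c1.
have j2 := test_integrable mD (Ck_continuous (s2 0)) c2.
have id : leb2.-integrable D (EFin \o (fun x => dot (c, - b) (phi x))).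
  exact: (integrableD mD (integrableZl mD c j1) (integrableZl mD (- b) j2)).
rewrite (@int2_eq _ _ (fun x => (d1 (fun x => (phi x).2 * aff a b c x) x -
    d2 (fun x => (phi x).1 * aff a b c x) x) + dot (c, - b) (phi x))); last first.
  by move=> x _; rewrite E1 E2 /ccurl /dot /=; ring.
rewrite int2D//; last exact: (integrableB mD i2 i1).
by rewrite int2B// Z1 Z2 subrr add0r.
Qed.

End WeakDerivatives.

(** * Barycentric coordinates *)

Section Triangle.
Context {R : realType}.
Local Notation i0 := (inord 0 : 'I_3).
Local Notation i1 := (inord 1 : 'I_3).
Local Notation i2 := (inord 2 : 'I_3).
Implicit Types (v : 'I_3 -> plane R) (x : plane R) (k : 'I_3).

Lemma ord3P k : [\/ k = i0, k = i1 | k = i2].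
Proof.
by case: k => -[|[|[|//]]] H; [constructor 1|constructor 2|constructor 3];
  apply: val_inj; rewrite /= inordK.
Qed.

Lemma sum3 (V : zmodType) (F : 'I_3 -> V) : \sum_k F k = F i0 + F i1 + F i2.
Proof.
rewrite !big_ord_recl big_ord0 addr0 addrA.
by congr (F _ + F _ + F _); apply: val_inj; rewrite /= ?inordK.
Qed.

Lemma ordS_i0 : ordS i0 = i1. Proof. by apply: val_inj; rewrite /= !inordK. Qed.
Lemma ordS_i1 : ordS i1 = i2. Proof. by apply: val_inj; rewrite /= !inordK. Qed.
Lemma ordS_i2 : ordS i2 = i0. Proof. by apply: val_inj; rewrite /= !inordK. Qed.
Definition ordSE := (ordS_i0, ordS_i1, ordS_i2).

(** The [k]-th barycentric coordinate, as the ratio of the signed area of the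
    triangle where vertex [k] is replaced by [x] to that of the whole. The
    indices are cyclic. *)
Definition bary v k x : R :=
  crossv (v (ordS k) - x) (v (ordS (ordS k)) - x) / cell_det v.

Definition bary_coef v k : R * R * R :=
  (crossv (v (ordS k)) (v (ordS (ordS k))) / cell_det v,
   ((v (ordS k)).2 - (v (ordS (ordS k))).2) / cell_det v,
   ((v (ordS (ordS k))).1 - (v (ordS k)).1) / cell_det v).

Lemma bary_aff v k x :
  bary v k x = aff (bary_coef v k).1.1 (bary_coef v k).1.2 (bary_coef v k).2 x.
Proof.
rewrite /bary /aff /bary_coef /=.
move: (v (ordS k)) (v (ordS (ordS k))) (cell_det v)^-1 x => [p1 p2] [q1 q2] d [x y].
rewrite /crossv /=; ring.
Qed.

Lemma bary_sum v x : cell_det v != 0 -> \sum_k bary v k x = 1.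
Proof.
move=> d0; rewrite sum3 /bary !ordSE -!mulrDl; apply: (mulIf d0).
by rewrite divfK// mul1r /cell_det /crossv /=; ring.
Qed.

Lemma bary_comb v x : cell_det v != 0 ->
  x = (\sum_k bary v k x * (v k).1, \sum_k bary v k x * (v k).2).
Proof.
move=> d0; rewrite [LHS]surjective_pairing !sum3 /bary !ordSE.
congr (_, _); apply: (mulIf d0);
  rewrite !mulrDl -!mulrA !(mulrCA _^-1) !mulVf// !mulr1 /cell_det /crossv /=;
  ring.
Qed.

Lemma bary_of_comb v (l : 'I_3 -> R) k : cell_det v != 0 -> \sum_k l k = 1 ->
  bary v k (\sum_k l k * (v k).1, \sum_k l k * (v k).2) = l k.
Proof.
move=> d0; rewrite !sum3 => l1; have {l1} l0 : l i0 = 1 - l i1 - l i2 by lra.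
apply: (mulIf d0); rewrite /bary divfK// /cell_det /crossv.
by case: (ord3P k) => ->; rewrite !ordSE /= l0; ring.
Qed.

Lemma bary_vtx v k : cell_det v != 0 -> bary v k (v k) = 1.
Proof.
move=> d0; rewrite /bary; apply: (mulIf d0); rewrite divfK// mul1r.
by case: (ord3P k) => ->; rewrite !ordSE /cell_det /crossv /=; ring.
Qed.

Lemma face_bary v A x k : cell_det v != 0 -> face v A x -> k \notin A ->
  bary v k x = 0.
Proof. by move=> d0 [l [_ lA l1 ->]] kA; rewrite bary_of_comb// lA. Qed.

Lemma triangleP v x : cell_det v != 0 ->
  triangle v x <-> forall k, 0 <= bary v k x.
Proof.
move=> d0; split=> [[l [l0 _ l1 ->]] k|b0]; first by rewrite bary_of_comb.
exists (fun k => bary v k x); split=> //.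
- by move=> k; rewrite inE.
- exact: bary_sum.
- exact: bary_comb.
Qed.

Lemma continuous_bary v k : continuous (bary v k).
Proof.
rewrite (_ : bary v k = aff (bary_coef v k).1.1 (bary_coef v k).1.2 (bary_coef v k).2).
  exact: continuous_aff.
by apply/funext => x; exact: bary_aff.
Qed.

(** If the coordinate at vertex [k] were zero at an interior point, moving from
    there away from vertex [k] would make it negative inside the triangle. *)
Lemma interior_triangleP v x : cell_det v != 0 ->
  (triangle v)° x <-> forall k, 0 < bary v k x.
Proof.
move=> d0; split=> [Tx k|b0].
  have /triangleP b0 := interior_subset Tx.
  rewrite lt_neqAle b0// andbT eq_sym; apply/eqP => bk0.
  have /nbhs_ballP[e /= e0 He] := Tx.
  pose w : plane R := v k.
  have n0 : 0 < `|x - w| + 1 by rewrite ltr_wpDl.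
  pose t := e / 2 / (`|x - w| + 1).
  have t0 : 0 < t by rewrite !divr_gt0.
  have /triangleP : triangle v (x + t *: (x - w)).
    apply: He; rewrite -ball_normE /ball_ /= opprD addNKr normrN normrZ gtr0_norm//.
    by have : t * (`|x - w| + 1) = e / 2; [rewrite /t divfK ?gt_eqF|lra].
  move=> /(_ d0 k); rewrite bary_aff.
  have -> : aff (bary_coef v k).1.1 (bary_coef v k).1.2 (bary_coef v k).2 (x + t *: (x - w))
     = (1 + t) * bary v k x - t * bary v k w.
    by rewrite !bary_aff /aff /= /GRing.scale /=; ring.
  by rewrite bk0 mulr0 bary_vtx// mulr1 sub0r oppr_ge0 leNgt t0.
have H k : \forall y \near x, 0 < bary v k y.
  have /(_ x) := @continuous_bary v k.
  by move=> /cvgr_gt; apply; exact: b0.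
rewrite /interior /=.
near=> y; apply/(triangleP _ d0) => k; apply: ltW.
by case: (ord3P k) => ->; near: y; exact: H.
Unshelve. all: end_near. Qed.

End Triangle.

(** * Triangles of a mesh *)

Section NullLines.
Context {R : realType}.
Implicit Types (v : 'I_3 -> plane R) (x : plane R) (k : 'I_3).

Definition line (a b c : R) : set (plane R) := [set x | aff a b c x = 0].

Lemma measurable_line a b c : meas2 (line a b c).
Proof.
have -> : line a b c = aff a b c @^-1` [set 0] by [].
rewrite -[_ @^-1` _]setTI; apply: continuous_meas2 => //.
exact: continuous_aff.
Qed.

(** The vertical sections are points, unless the line itself is vertical. *)
Lemma leb2_line a b c : (b != 0) || (c != 0) -> leb2 (line a b c) = 0%E.
Proof.
move=> bc; have [c0|c0] := eqVneq c 0.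
  move: bc; rewrite c0 eqxx orbF => b0.
  have -> : line a b 0 = [set - a / b] `*` setT.
    apply/seteqP; split => -[x y]; rewrite /line /aff /= mul0r addr0.
      by move=> h; split => //; apply: (mulIf b0); rewrite divfK//; lra.
    by move=> [-> _]; rewrite mulrC divfK// subrr.
  by rewrite /leb2 product_measure1E//= lebesgue_measure_set1 mul0e.
rewrite /leb2 /product_measure1 integral0_eq// => x _ /=.
rewrite (_ : xsection _ _ = [set - (a + b * x) / c]) ?lebesgue_measure_set1//.
apply/seteqP; split => y; rewrite /xsection /= ?inE /line /aff /=.
  by move=> h; apply: (mulIf c0); rewrite divfK//; lra.
by move=> ->; rewrite [c * _]mulrC divfK// subrr.
Qed.

Lemma bary_line v k : [set x | bary v k x = 0] =
  line (bary_coef v k).1.1 (bary_coef v k).1.2 (bary_coef v k).2.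
Proof. by apply/seteqP; split=> x; rewrite /line /= bary_aff. Qed.

(** A barycentric coordinate takes the values 1 and 0, so it is not constant and
    its zero set is a line. *)
Lemma leb2_bary0 v k : cell_det v != 0 -> leb2 [set x | bary v k x = 0] = 0%E.
Proof.
move=> d0; rewrite bary_line; apply: leb2_line; apply/negPn/negP.
rewrite negb_or !negbK => /andP[/eqP b0 /eqP c0].
have H x : bary v k x = (bary_coef v k).1.1.
  by rewrite bary_aff /aff b0 c0 !mul0r !addr0.
have := bary_vtx k d0; rewrite H -(H (v (ordS k))).
rewrite /bary subrr /crossv /= !mul0r subrr mul0r => /eqP.
by rewrite eq_sym oner_eq0.
Qed.

Lemma measurable_bary0 v k : meas2 [set x | bary v k x = 0].
Proof. by rewrite bary_line; exact: measurable_line. Qed.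

Lemma measurable_interior_triangle v : meas2 (triangle v)°.
Proof. by apply: open_meas2; exact: open_interior. Qed.

Definition edge_lines v : set (plane R) := \bigcup_(k in [set: 'I_3]) [set x | bary v k x = 0].

Lemma triangle_interior_edges v x : cell_det v != 0 -> triangle v x ->
  (triangle v)° x \/ edge_lines v x.
Proof.
move=> d0 /(triangleP _ d0) b0.
have [[k bk]|h] := pselect (exists k, bary v k x = 0).
  by right; exists k.
left; apply/(interior_triangleP _ d0) => k; rewrite lt_neqAle b0 andbT eq_sym.
by apply/eqP => bk; apply: h; exists k.
Qed.

Lemma negligible_edges v : cell_det v != 0 -> leb2.-negligible (edge_lines v).
Proof.
move=> d0.
have -> : edge_lines v = \bigcup_n (if pselect (n < 3)%N is left h then
    [set x | bary v (Ordinal h) x = 0] else set0).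
  apply/seteqP; split => x.
    move=> [[k hk] _ bk]; exists k => //.
    by case: pselect => // h; rewrite (_ : Ordinal h = Ordinal hk)//; exact: val_inj.
  by move=> [n _]; case: pselect => // h bh; exists (Ordinal h).
apply: negligible_bigcup => n; case: pselect => [h|_]; last exact: negligible_set0.
exists [set x | bary v (Ordinal h) x = 0]; split => //.
- exact: measurable_bary0.
- exact: leb2_bary0.
Qed.

End NullLines.

Section MeshDomain.
Context {R : realType} (Omega : set (plane R)) (Th : mesh Omega).
Hypothesis lipO : lipschitz_domain Omega.
Implicit Types (x : plane R) (w : cell Th).

Lemma vtx_det_neq0 w : cell_det (vtx w) != 0.
Proof. by rewrite gt_eqF// vtx_ccw. Qed.

(** From a boundary point, a small step in the direction [- e] leads strictly
    below the Lipschitz graph, hence out of the closure of the domain. So no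
    boundary point is interior to that closure. *)
Lemma interior_closure_lipschitz : (closure Omega)° `<=` Omega.
Proof.
case: lipO => [_ oO _ _ lipb] x cx; apply: contrapT => nx.
have bx : bdry Omega x.
  by split; [exact: interior_subset|exact: subset_closure].
have [e [L [gam [e1 gamL nearx]]]] := lipb x bx.
have ee : dot e e = 1.
  by rewrite -[LHS]sqr_sqrtr -/(enorm e) ?e1 ?expr1n// addr_ge0// -expr2 sqr_ge0.
have gam0 : 0 <= gam 0.
  rewrite leNgt; apply/negP => g0; apply: nx.
  have /nbhs_singleton [_] := nearx; apply.
  by rewrite subrr /crossv /dot /= !mulr0 subrr addr0.
have : nbhs x ([set y | Omega y <-> gam (crossv e (y - x)) < dot e (y - x)]
    `&` closure Omega) by exact: filterI nearx cx.
move=> /nbhs_ballP[d /= d0 Hd].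
pose t := d / 2 / (`|e| + 1).
have e0 : 0 < `|e| + 1 by rewrite ltr_wpDl.
have t0 : 0 < t by rewrite !divr_gt0.
pose y : plane R := x - t *: e.
have By : ball x d y.
  rewrite -ball_normE /ball_ /= /y opprD addNKr opprK normrZ gtr0_norm//.
  by have : t * (`|e| + 1) = d / 2; [rewrite /t divfK ?gt_eqF|lra].
have [_ cy] := Hd _ By.
pose h (z : plane R) := gam (crossv e (z - x)) - dot e (z - x).
have hy : 0 < h y.
  have -> : h y = gam 0 + t.
    rewrite /h (_ : y - x = - t *: e); last by rewrite /y scaleNr addrC addKr.
    have -> : crossv e (- t *: e) = 0 by rewrite /crossv /= /GRing.scale /=; ring.
    have -> : dot e (- t *: e) = - t * dot e e.
      by rewrite /dot /= /GRing.scale /=; ring.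
    by rewrite ee mulr1 opprK.
  by rewrite ltr_wpDl.
have cdot (u : plane R) : continuous (fun z : plane R => dot u (z - x)).
  rewrite (_ : (fun z => _) = aff (- dot u x) u.1 u.2); first exact: continuous_aff.
  by apply/funext => z; rewrite /aff /dot /=; ring.
have ccross : continuous (fun z : plane R => crossv e (z - x)).
  rewrite (_ : (fun z => _) = aff (- crossv e x) (- e.2) e.1); first exact: continuous_aff.
  by apply/funext => z; rewrite /aff /crossv /=; ring.
have cgam : continuous gam.
  move=> s; apply/cvgrPdist_le => eps eps0.
  have L0 : 0 < `|L| + 1 by rewrite ltr_wpDl.
  near=> r; apply: le_trans (gamL s r) _.
  have : `|s - r| <= eps / (`|L| + 1).
    by near: r; apply: cvgr_dist_le; [exact: cvg_id|exact: divr_gt0].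
  rewrite ler_pdivlMr// => sr; apply: le_trans sr; rewrite mulrC.
  by apply: ler_wpM2l => //; rewrite (le_trans (ler_norm L))// lerDl.
have ch : continuous h.
  move=> z; apply: (@continuousB _ _ _ (fun z : plane R => gam (crossv e (z - x)))
    (fun z : plane R => dot e (z - x))); last exact: cdot.
  apply: (@continuous_comp _ _ _ (fun z : plane R => crossv e (z - x)) gam).
    exact: ccross.
  exact: cgam.
have By' : \forall z \near y, ball x d z.
  by apply: open_nbhs_nbhs; split => //; exact: ball_open.
have hz : \forall z \near y, 0 < h z.
  by have /(_ y) /cvgr_gt := ch; apply.
have nO : \forall z \near y, ~ Omega z.
  apply: filterS2 By' hz => z Bz; rewrite subr_gt0 => hz Oz.
  by have [/(_ Oz)] := (Hd z Bz).1; rewrite ltNge (ltW hz).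
have [z [Oz nOz]] := cy _ nO.
exact: nOz.
Unshelve. all: end_near. Qed.

Lemma interior_triangle_sub w : (triangle (vtx w))° `<=` Omega.
Proof.
apply: subset_trans interior_closure_lipschitz; apply: interiorS.
by rewrite (mesh_cover Th) => x Tx; exists w.
Qed.

(** A common interior point would lie on a proper face of one of the triangles,
    where some barycentric coordinate vanishes. *)
Lemma interior_triangle_disjoint w w' x :
  (triangle (vtx w))° x -> (triangle (vtx w'))° x -> w = w'.
Proof.
move=> Tx Tx'; apply/eqP/negPn/negP => ww'.
have fx := mesh_conforming ww' (conj (interior_subset Tx) (interior_subset Tx')).
have [k kn] : exists k, k \notin shared (vtx w) (vtx w').
  have := mesh_distinct ww'; rewrite -finset.subTset => /subsetPn[k _ kn].
  by exists k.
have := face_bary (vtx_det_neq0 w) fx kn.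
move/(interior_triangleP _ (vtx_det_neq0 w)) : Tx => /(_ k) + k0.
by rewrite k0 ltxx.
Qed.

Lemma ae_interior_triangle :
  {ae leb2, forall x, Omega x -> exists w, (triangle (vtx w))° x}.
Proof.
pose F n := if unpickle n is Some w then edge_lines (vtx (w : cell Th)) else set0.
have [N [mN N0 sN]] : leb2.-negligible (\bigcup_n F n).
  apply: negligible_bigcup => n; rewrite /F; case: unpickle => [w|].
    exact/negligible_edges/vtx_det_neq0.
  exact: negligible_set0.
exists N; split => // x /= nx; apply: sN.
have Ox : Omega x by apply: contrapT => nO; apply: nx => /nO.
have : closure Omega x by exact: subset_closure.
rewrite (mesh_cover Th) => -[w _ Tw].
have [iw|ew] := triangle_interior_edges (vtx_det_neq0 w) Tw.
  by exfalso; apply: nx => _; exists w.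
by exists (pickle w) => //; rewrite /F pickleK.
Qed.

Lemma open_Omega : open Omega. Proof. by case: lipO. Qed.
Lemma bounded_Omega : bounded_set Omega. Proof. by case: lipO. Qed.
Lemma meas2_Omega : meas2 Omega. Proof. by apply: open_meas2; exact: open_Omega. Qed.
Lemma leb2_Omega : (leb2 Omega < +oo)%E.
Proof. exact: bounded_leb2_lty meas2_Omega bounded_Omega. Qed.

Lemma leb2_interior_triangle w : (leb2 (triangle (vtx w))° < +oo)%E.
Proof.
apply: le_lt_trans leb2_Omega; apply: le_measure; rewrite ?inE.
- exact: measurable_interior_triangle.
- exact: meas2_Omega.
- exact: interior_triangle_sub.
Qed.

Lemma int2_sum (I : Type) (s : seq I) D (F : I -> plane R -> R) : meas2 D ->
  (forall i, leb2.-integrable D (EFin \o F i)) ->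
  int2 D (fun x => \sum_(i <- s) F i x) = \sum_(i <- s) int2 D (F i).
Proof.
move=> mD iF; rewrite /int2 /Rintegral.
under eq_integral do rewrite -sumEFin.
rewrite integral_sum// -sum_fine//.
by move=> i _; exact: (integrable_fin_num mD (iF i)).
Qed.

(** Only the edges are missed by the open triangles. *)
Lemma int2_mesh f : leb2.-integrable Omega (EFin \o f) ->
  int2 Omega f = \sum_(w : cell Th) int2 (triangle (vtx w))° f.
Proof.
move=> iF; have mO := meas2_Omega.
have mf : measurable_fun Omega (f : measurableTypeR R * measurableTypeR R -> R).
  by apply/measurable_EFinP; exact: measurable_int iF.
have i1 w : leb2.-integrable Omega (EFin \o (fun x => f x * \1_(triangle (vtx w))° x)).
  apply: integrableM_bounded => //.
    by apply: measurable_indic; exact: measurable_interior_triangle.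
  exists 1; split => // y y1 x _; apply: le_trans (ltW y1).
  by rewrite /= indicE; case: (_ \in _); rewrite ?normr0 ?normr1.
transitivity (int2 Omega (fun x => \sum_(w : cell Th) f x * \1_(triangle (vtx w))° x)).
  apply: int2_ae => //.
    apply/measurable_EFinP.
    have -> : EFin \o (fun x => \sum_(w : cell Th) f x * \1_(triangle (vtx w))° x) =
       (fun x => \sum_(w : cell Th) (f x * \1_(triangle (vtx w))° x)%:E)%E.
      by apply/funext => x; rewrite /= sumEFin.
    by apply: emeasurable_sum => w; exact: measurable_int (i1 w).
  apply: filterS ae_interior_triangle => x h Ox; have [w Tw] := h Ox.
  rewrite -mulr_sumr (bigD1 w)//= big1 => [|w' w'w].
    by rewrite indicE mem_set// addr0 mulr1.
  rewrite indicE memNset// => Tw'; move: w'w.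
  by rewrite (interior_triangle_disjoint Tw' Tw) eqxx.
rewrite int2_sum//; apply: eq_bigr => w _.
rewrite -(int2_support (@interior_triangle_sub w)).
  by apply: int2_eq => x Tx; rewrite indicE mem_set// mulr1.
by move=> x _ nT; rewrite indicE memNset// mulr0.
Qed.

End MeshDomain.

(** * Affine change of variables *)

Section AffineChange.
Local Open Scope ereal_scope.
Context {R : realType}.
Local Notation mu := (@lebesgue_measure R).
Local Notation mR := (measurableTypeR R).
Local Notation mplane := (measurableTypeR R * measurableTypeR R)%type.

Lemma measurable_affine (a b : R) :
  measurable_fun setT ((fun s => a * s + b)%R : mR -> mR).
Proof.
by apply: measurable_funD => //; apply: measurable_funM => //; exact: measurable_id.
Qed.

(** Both sides are measures, so it suffices to compare them on intervals. *)
Lemma lebesgue_measure_affine (a b : R) (A : set mR) : (a != 0)%R -> measurable A ->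
  mu A = (`|a|%R)%:E * pushforward mu ((fun s => a * s + b)%R : mR -> mR) A.
Proof.
move=> a0 mA.
pose M : {measure set mR -> \bar R} :=
  measure_function_pushforward__canonical__measure_function_Measure mu
    (measurable_affine a b).
pose k : {nonneg R} := NngNum (normr_ge0 a).
have -> : (`|a|%R)%:E * pushforward mu ((fun s => a * s + b)%R : mR -> mR) A =
  mscale k M A by [].
apply: lebesgue_measure_unique => // _ [[x y] _ <-] /=.
rewrite /mscale /= /pushforward lebesgue_measure_itv /= lte_fin -EFinB.
have [a_gt0|a_lt0|aE] := ltgtP 0%R a; last by rewrite -aE eqxx in a0.
  have -> : (fun s => a * s + b)%R @^-1` `]x, y]%classic =
      `]((x - b) / a)%R, ((y - b) / a)%R]%classic.
    apply/seteqP; split => s; rewrite /= !in_itv/= ltr_pdivrMr// ler_pdivlMr//;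
    by rewrite ltrBlDr lerBrDr [(s * a)%R]mulrC.
  rewrite lebesgue_measure_itv /= lte_fin ltr_pM2r ?invr_gt0// ltrD2r.
  case: ifP => _; last by rewrite mule0.
  rewrite -EFinB -EFinM gtr0_norm// -mulrBl mulrC divfK//.
  by congr (_%:E); ring.
have -> : (fun s => a * s + b)%R @^-1` `]x, y]%classic =
    `[((y - b) / a)%R, ((x - b) / a)%R[%classic.
  apply/seteqP; split => s; rewrite /= !in_itv/= ler_ndivrMr// ltr_ndivlMr//;
  by rewrite ltrBlDr lerBrDr [(s * a)%R]mulrC => /andP[-> ->].
rewrite lebesgue_measure_itv /= lte_fin ltr_nM2r ?invr_lt0// ltrD2r.
case: ifP => _; last by rewrite mule0.
rewrite -EFinB -EFinM ltr0_norm// -mulrBl mulrC mulrN divfK//.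
by congr (_%:E); ring.
Qed.

Lemma ge0_integral_affine (a b : R) (h : R -> \bar R) : (a != 0)%R ->
  measurable_fun setT (h : mR -> \bar R) -> (forall x, 0 <= h x) ->
  \int[mu]_s h (a * s + b)%R = (`|a|^-1)%:E * \int[mu]_x h x.
Proof.
move=> a0 mh h0; have na0 : (`|a| != 0)%R by rewrite normr_eq0.
pose M : {measure set mR -> \bar R} :=
  measure_function_pushforward__canonical__measure_function_Measure mu
    (measurable_affine a b).
pose k : {nonneg R} := NngNum (normr_ge0 a).
have -> : \int[mu]_x h x = \int[mscale k M]_x h x.
  by apply: eq_measure_integral => //= A mA _; exact: lebesgue_measure_affine.
rewrite ge0_integral_mscale// muleA -EFinM /= mulVf// mul1e.
rewrite ge0_integral_pushforward//.
exact: measurable_affine.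
Qed.

Lemma tonelli_xy (f : plane R -> \bar R) :
  measurable_fun setT (f : mplane -> \bar R) -> (forall x, 0 <= f x) ->
  \int[leb2]_z f z = \int[mu]_x \int[mu]_y f (x, y).
Proof. by move=> mf f0; exact: (@fubini_tonelli1 _ _ mR mR R mu mu f mf f0). Qed.

Lemma tonelli_yx (f : plane R -> \bar R) :
  measurable_fun setT (f : mplane -> \bar R) -> (forall x, 0 <= f x) ->
  \int[leb2]_z f z = \int[mu]_y \int[mu]_x f (x, y).
Proof. by move=> mf f0; exact: (@fubini_tonelli2 _ _ mR mR R mu mu f mf f0). Qed.

Section Plane.
Variables (a u1 w1 b u2 w2 : R).
Let det : R := (u1 * w2 - u2 * w1)%R.
Hypothesis det0 : det != 0%R.

Definition affine_map (z : plane R) : plane R :=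
  (a + u1 * z.1 + w1 * z.2, b + u2 * z.1 + w2 * z.2)%R.

Lemma measurable_affine_map : measurable_fun setT (affine_map : mplane -> mplane).
Proof.
apply/measurable_fun_pairP; split.
- exact: (continuous_meas2 (@continuous_aff R a u1 w1)).
- exact: (continuous_meas2 (@continuous_aff R b u2 w2)).
Qed.

(** The substitution is made in one variable at a time, which costs the factors
    [u1] and [det / u1]; the order of integration is exchanged in between. *)
Lemma ge0_integral_affine_map1 (f : plane R -> \bar R) : u1 != 0%R ->
  measurable_fun setT (f : mplane -> \bar R) -> (forall x, 0 <= f x) ->
  \int[leb2]_z f (affine_map z) = (`|det|^-1)%:E * \int[leb2]_x f x.
Proof.
move=> u10 mf f0.
have mfA : measurable_fun setT ((f \o affine_map) : mplane -> \bar R).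
  by apply: measurableT_comp => //; exact: measurable_affine_map.
rewrite (tonelli_yx mfA)//=.
pose g (z : plane R) : plane R :=
  (z.1, b + u2 / u1 * (z.1 - a - w1 * z.2) + w2 * z.2)%R.
have mg : measurable_fun setT (g : mplane -> mplane).
  apply/measurable_fun_pairP; split; first exact: measurable_fst.
  rewrite (_ : snd \o g = aff (b - u2 / u1 * a) (u2 / u1) (w2 - u2 / u1 * w1)).
    exact: (continuous_meas2 (@continuous_aff R _ _ _)).
  by apply/funext => z; rewrite /g /aff /=; ring.
have mfg : measurable_fun setT ((f \o g) : mplane -> \bar R).
  by apply: measurableT_comp.
transitivity (\int[mu]_t ((`|u1|^-1)%:E * \int[mu]_x f (g (x, t)))).
  apply: eq_integral => t _.
  rewrite -(@ge0_integral_affine u1 (a + w1 * t) (fun x => f (g (x, t))))//.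
    apply: eq_integral => s _ /=; congr (f _); rewrite /affine_map /g /=.
    by congr (_, _); [ring|field].
  exact: (measurableT_comp mfg (pair2_measurable _)).
have mG : measurable_fun setT (fun t : mR => \int[mu]_x f (g (x, t))).
  exact: (@measurable_fun_fubini_tonelli_G _ _ mR mR R mu _ mfg (fun z => f0 (g z))).
rewrite (ge0_integralZl mu measurableT mG)//; last first.
  by move=> t _; exact: integral_ge0.
have fg0 z : 0 <= (f \o g) z by exact: f0.
have E : \int[mu]_t \int[mu]_x f (g (x, t)) = \int[mu]_x \int[mu]_t f (g (x, t)).
  exact: etrans (esym (tonelli_yx mfg fg0)) (tonelli_xy mfg fg0).
rewrite E (tonelli_xy mf f0).
have c0 : (det / u1 != 0)%R by rewrite mulf_neq0// invr_eq0.
transitivity ((`|u1|^-1)%:E * \int[mu]_x ((`|det / u1|^-1)%:E * \int[mu]_y f (x, y))).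
  congr (_ * _); apply: eq_integral => x _ /=.
  rewrite -(@ge0_integral_affine (det / u1) (b + u2 / u1 * (x - a))
    (fun y => f (x, y)) c0 (measurableT_comp mf (pair1_measurable _))
    (fun y => f0 (x, y))).
  apply: eq_integral => s _ /=; congr (f _); rewrite /g /=.
  by congr (_, _); rewrite /det; field.
have mF : measurable_fun setT (fun x : mR => \int[mu]_y f (x, y)).
  exact: (@measurable_fun_fubini_tonelli_F _ _ mR mR R mu _ mf f0).
have c1 : 0 <= (`|det / u1|^-1)%:E by rewrite lee_fin invr_ge0.
have F0 x : setT x -> 0 <= \int[mu]_y f (x, y) by move=> _; exact: integral_ge0.
rewrite (ge0_integralZl mu measurableT mF F0 c1).
rewrite muleA -EFinM; congr (_%:E * _).
rewrite normf_div invf_div mulrA mulVf ?mul1r// normr_eq0; exact: u10.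
Qed.

End Plane.

Lemma ge0_integral_swap (f : plane R -> \bar R) :
  measurable_fun setT (f : mplane -> \bar R) -> (forall x, 0 <= f x) ->
  \int[leb2]_z f (z.2, z.1) = \int[leb2]_z f z.
Proof.
move=> mf f0.
have mfs : measurable_fun setT ((fun z => f (z.2, z.1)) : mplane -> \bar R).
  apply: (measurableT_comp mf (g := fun z : mplane => (z.2, z.1))).
  exact: measurable_swap.
by rewrite (tonelli_xy mf)// (tonelli_yx mfs).
Qed.

(** When [u1] is zero, exchanging the two variables replaces it by [w1], which
    is then nonzero. *)
Lemma ge0_integral_affine_map (a u1 w1 b u2 w2 : R) (f : plane R -> \bar R) :
  (u1 * w2 - u2 * w1 != 0)%R ->
  measurable_fun setT (f : mplane -> \bar R) -> (forall x, 0 <= f x) ->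
  \int[leb2]_z f (affine_map a u1 w1 b u2 w2 z) =
  (`|u1 * w2 - u2 * w1|^-1)%:E * \int[leb2]_x f x.
Proof.
move=> det0 mf f0; have [u10|u10] := eqVneq u1 0%R; last first.
  exact: ge0_integral_affine_map1.
have w10 : w1 != 0%R.
  by apply: contra_neq det0 => ->; rewrite u10 mul0r mulr0 subrr.
have det0' : (w1 * u2 - w2 * u1 != 0)%R.
  by rewrite -oppr_eq0 opprB [(w1 * _)%R]mulrC [(w2 * _)%R]mulrC.
rewrite -[(u1 * w2 - _)%R]opprB normrN [(u2 * _)%R]mulrC [(u1 * _)%R]mulrC.
rewrite -(ge0_integral_affine_map1 a b det0')//.
have ms := measurableT_comp mf (measurable_affine_map a w1 u1 b w2 u2).
transitivity (\int[leb2]_z (f \o affine_map a w1 u1 b w2 u2) (z.2, z.1)).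
  apply: eq_integral => z _ /=; congr (f _).
  by rewrite /affine_map /=; congr (_, _); ring.
by apply: (ge0_integral_swap ms) => z; exact: f0.
Qed.

End AffineChange.

(** * Exactness of the vertex rule *)

Section Quadrature.
Context {R : realType}.
Local Notation mu := (@lebesgue_measure R).
Local Notation mR := (measurableTypeR R).
Local Notation mplane := (measurableTypeR R * measurableTypeR R)%type.
Local Notation i0 := (inord 0 : 'I_3).
Local Notation i1 := (inord 1 : 'I_3).
Local Notation i2 := (inord 2 : 'I_3).
Implicit Types (v : 'I_3 -> plane R) (k : 'I_3).

Definition ref_coord (z : plane R) : R :=
  if [&& 0 < z.1, 0 < z.2 & z.1 + z.2 < 1] then z.1 else 0.

Lemma integral_ref_slice (s : R) :
  (\int[mu]_t (ref_coord (s, t))%:E =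
   if ((0 < s) && (s < 1))%R then (s * (1 - s))%:E else 0)%E.
Proof.
have [s0|s0] := ltP 0 s; last first.
  by rewrite integral0_eq// => t _; rewrite /ref_coord /= ltNge s0.
transitivity (\int[mu]_(t in `]0%R, (1 - s)%R[) s%:E)%E.
  rewrite [RHS]integral_mkcond; apply: eq_integral => t _.
  rewrite patchE /ref_coord /= s0 /= mem_setE in_itv /= ltrBrDl.
  by case: ifP.
rewrite integral_cst//= lebesgue_measure_itv /= lte_fin subr_gt0.
by case: ifP => _; rewrite ?mule0// -EFinB subr0 -EFinM.
Qed.

Lemma integral_ref : measurable_fun setT (ref_coord : mplane -> R) ->
  (\int[leb2]_z (ref_coord z)%:E = (6^-1)%:E)%E.
Proof.
move=> mref; rewrite tonelli_xy; first last.
- move=> z; rewrite lee_fin /ref_coord; case: ifP => // /and3P[z0 _ _]; exact: ltW.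
- exact/measurable_EFinP.
under eq_integral do rewrite integral_ref_slice.
transitivity (\int[mu]_(s in `[0%R, 1%R]) (s * (1 - s))%:E)%E.
  rewrite [RHS]integral_mkcond; apply: eq_integral => s _.
  rewrite patchE mem_setE in_itv /=.
  have [s0|s0|<-] := ltgtP 0 s => //=; last by rewrite mul0r; case: ifP.
  by have [s1|s1|->] := ltgtP s 1 => //=; rewrite subrr mulr0.
pose p : {poly R} := 2^-1 *: 'X^2 - 3^-1 *: 'X^3.
pose F := horner p.
have dF (s : R) : is_derive s (1 : R) F (s * (1 - s)).
  have dp : deriv p = 'X - 'X^2.
    rewrite /p derivB !derivZ !derivXn.
    rewrite -['X^(2.-1) *+ 2]scaler_nat -['X^(3.-1) *+ 3]scaler_nat !scalerA.
    by rewrite !mulVf ?pnatr_eq0// !scale1r.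
  have := is_derive_poly p s; rewrite dp !hornerE.
  by rewrite mulrBr mulr1 expr2.
have cF : continuous F.
  move=> x; apply: differentiable_continuous; apply/derivable1_diffP.
  by have [] := dF x.
rewrite (@continuous_FTC2 _ (fun s => s * (1 - s)) F)//; first last.
- by move=> x _; rewrite derive1E; have [_ ->] := dF x.
- split=> [x _||]; first by have [] := dF x.
    exact/cvg_at_right_filter/cF.
  exact/cvg_at_left_filter/cF.
- apply: continuous_subspaceT => x.
  apply: (@continuousM _ _ id (fun s => 1 - s)); first exact: cvg_id.
  by apply: cvgB; [exact: cvg_cst|exact: cvg_id].
rewrite -EFinB /F /p !(hornerD, hornerN, hornerZ, hornerXn).
by rewrite !expr1n !expr0n /=; congr (_%:E); field.
Qed.

(** With vertex [k + 2] as origin, the reference triangle is mapped to the given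
    one so that its first coordinate becomes the [k]-th barycentric one. *)
Lemma integral_bary v k : 0 < cell_det v ->
  int2 (triangle v)° (bary v k) = cell_det v / 6.
Proof.
move=> d0; have dn0 : cell_det v != 0 by rewrite gt_eqF.
pose j := ordS (ordS k); pose u := v k - v j; pose w := v (ordS k) - v j.
pose Phi := affine_map (v j).1 u.1 w.1 (v j).2 u.2 w.2.
have detE : u.1 * w.2 - u.2 * w.1 = cell_det v.
  rewrite /u /w /j /cell_det /crossv.
  by case: (ord3P k) => ->; rewrite !ordSE /=; ring.
have baryE z : [/\ bary v k (Phi z) = z.1, bary v (ordS k) (Phi z) = z.2 &
    bary v j (Phi z) = 1 - z.1 - z.2].
  rewrite /bary; split; apply: (mulIf dn0); rewrite divfK// -detE;
    rewrite /Phi /affine_map /u /w /j /crossv;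
    case: (ord3P k) => ->; rewrite !ordSE; case: z;
    move: (v i0) (v i1) (v i2) => [a0 b0] [a1 b1] [a2 b2] s t /=; ring.
have kall i : [\/ i = k, i = ordS k | i = j].
  rewrite /j; case: (ord3P k) => ->; rewrite !ordSE; case: (ord3P i) => ->;
    by [constructor 1|constructor 2|constructor 3].
pose f := (EFin \o bary v k) \_ (triangle v)°.
have f0 x : (0 <= f x)%E.
  rewrite /f patchE; case: ifPn => // /set_mem /(interior_triangleP _ dn0) b0.
  by rewrite lee_fin ltW.
have mf : measurable_fun setT (f : mplane -> \bar R).
  apply: (measurable_restrictT _ (measurable_interior_triangle v)).1.
  apply/measurable_EFinP; apply: measurable_funTS.
  exact: (continuous_meas2 (@continuous_bary R v k)).
have fPhi z : f (Phi z) = (ref_coord z)%:E.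
  have [b1 b2 b3] := baryE z.
  have E : (triangle v)° (Phi z) <-> [&& 0 < z.1, 0 < z.2 & z.1 + z.2 < 1].
    split=> [/(interior_triangleP _ dn0) b0|/and3P[z1 z2 z3]].
      have := b0 k; have := b0 (ordS k); have := b0 j.
      by rewrite b1 b2 b3 => ? -> ->/=; lra.
    apply/(interior_triangleP _ dn0) => i.
    by case: (kall i) => ->; rewrite ?b1 ?b2 ?b3//; lra.
  rewrite /f patchE /ref_coord; case: ifPn => [/set_mem/E ->|].
    by rewrite /= b1.
  by rewrite notin_setE => nE; case: ifPn => // /E.
have mref : measurable_fun setT (ref_coord : mplane -> R).
  apply/measurable_EFinP.
  rewrite (_ : EFin \o _ = f \o Phi); last by apply/funext => z; rewrite /= fPhi.
  by apply: measurableT_comp => //; exact: measurable_affine_map.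
have I : ((6^-1)%:E = (`|cell_det v|^-1)%:E * \int[leb2]_x f x)%E.
  rewrite -(integral_ref mref) -detE.
  rewrite -(ge0_integral_affine_map (v j).1 (v j).2)//; last by rewrite detE.
  by apply: eq_integral => z _; rewrite -fPhi.
rewrite /int2 /Rintegral integral_mkcond -/f.
have -> : (\int[leb2]_x f x = (cell_det v)%:E * (6^-1)%:E)%E.
  by rewrite I muleA -EFinM gtr0_norm// divff// mul1e.
by rewrite -EFinM.
Qed.

Lemma L2_bary v k : 0 < cell_det v -> (leb2 (triangle v)° < +oo)%E ->
  L2 (triangle v)° (bary v k).
Proof.
move=> d0 fT; have dn0 : cell_det v != 0 by rewrite gt_eqF.
apply: L2_bounded => //; first exact: measurable_interior_triangle.
  by apply: measurable_funTS; apply: continuous_meas2; exact: continuous_bary.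
exists 1; split => // y y1 x Tx; apply: le_trans (ltW y1).
have /(interior_triangleP _ dn0) b0 := Tx.
rewrite /= ger0_norm; last exact: ltW.
rewrite -[leRHS](bary_sum x dn0) (bigD1 k)//= lerDl.
by apply: sumr_ge0 => i _; exact: ltW.
Qed.

(** An affine function is the combination of the barycentric coordinates with its
    vertex values, and each coordinate integrates to a third of the area. *)
Lemma quadrature_exact v (r : plane R -> R) (a b c : R) : 0 < cell_det v ->
  (leb2 (triangle v)° < +oo)%E ->
  (forall x, triangle v x -> r x = a + b * x.1 + c * x.2) ->
  int2 (triangle v)° r = cell_det v / 2 / 3 * \sum_k r (v k).
Proof.
move=> d0 fT rT; have dn0 : cell_det v != 0 by rewrite gt_eqF.
have mT := measurable_interior_triangle v.
have vT k : triangle v (v k).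
  exists (fun j => (j == k)%:R); split.
  - by move=> j; rewrite ler0n.
  - by move=> j; rewrite inE.
  - by rewrite (bigD1 k)//= eqxx big1 ?addr0// => j /negPf ->.
  rewrite [LHS]surjective_pairing; congr (_, _);
  by rewrite (bigD1 k)//= eqxx mul1r big1 ?addr0// => j /negPf ->; rewrite mul0r.
have ib k : leb2.-integrable (triangle v)° (EFin \o (fun x => r (v k) * bary v k x)).
  have iB : leb2.-integrable (triangle v)° (EFin \o bary v k).
    by apply: L2_integrable => //; exact: L2_bary.
  exact: (integrableZl mT (r (v k)) iB).
transitivity (int2 (triangle v)° (fun x => \sum_k r (v k) * bary v k x)).
  apply: int2_eq => x /interior_subset Tx; rewrite rT//.
  have := bary_sum x dn0; have := bary_comb x dn0.
  rewrite !sum3 !rT//.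
  move: (bary v _ x) (bary v _ x) (bary v _ x) => l0 l1 l2.
  case: x {Tx} => x y [-> ->] /= l; rewrite -[a in LHS]mulr1 -l; ring.
rewrite int2_sum// mulr_sumr; apply: eq_bigr => k _.
rewrite int2Zl//; last by apply: L2_integrable => //; exact: L2_bary.
by rewrite integral_bary// mulrC; field.
Qed.

End Quadrature.

(** * The curl of an elementwise linear function *)

Section Discrete.
Context {R : realType} (Omega : set (plane R)) (Th : mesh Omega).
Hypothesis lipO : lipschitz_domain Omega.
Local Notation mplane := (measurableTypeR R * measurableTypeR R)%type.
Implicit Types (w : cell Th) (r : plane R -> R) (q c : plane R -> plane R).

Let oO : open Omega := open_Omega lipO.
Let bO : bounded_set Omega := bounded_Omega lipO.
Let mO : meas2 Omega := meas2_Omega lipO.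
Let fO : (leb2 Omega < +oo)%E := leb2_Omega lipO.

Lemma is_curl0 : is_curl Omega (fun=> 0) (fun=> 0).
Proof.
split=> [|phi _ _]; first exact: L2v0.
by apply: int2_eq => x _; rewrite /dot /= !mul0r addr0.
Qed.

Lemma int2_0 (f : plane R -> R) : (forall x, Omega x -> f x = 0) -> int2 Omega f = 0.
Proof.
move=> f0; rewrite (@int2_eq _ _ _ (fun=> 0)) /int2//.
by rewrite /Rintegral integral0.
Qed.

Lemma is_div0 : is_div Omega (fun=> 0) (fun=> 0).
Proof.
split=> [|psi _ _]; first exact: L20.
by rewrite !int2_0 ?oppr0// => x _; rewrite /dot /= ?mul0r ?addr0.
Qed.

Lemma int2_ae0 (f : plane R -> R) : measurable_fun Omega (f : mplane -> R) ->
  {ae leb2, forall x, Omega x -> f x = 0} -> int2 Omega f = 0.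
Proof.
move=> mf f0; rewrite (@int2_ae _ _ _ (fun=> 0))//; exact: int2_0.
Qed.

Lemma L2v_measurable_dot q c : L2v Omega q -> L2v Omega c ->
  measurable_fun Omega ((fun x => dot (q x) (c x)) : mplane -> R).
Proof.
by move=> [q1 q2] [c1 c2]; apply: measurable_dot; exact: L2_measurable.
Qed.

Lemma int2_dot_ae q c c' : L2v Omega q -> L2v Omega c -> L2v Omega c' ->
  {ae leb2, forall x, Omega x -> c x = c' x} ->
  int2 Omega (fun x => dot (c x) (q x)) = int2 Omega (fun x => dot (c' x) (q x)).
Proof.
move=> Lq Lc Lc' cc'; apply: int2_ae => //; [exact: L2v_measurable_dot|exact: L2v_measurable_dot|].
by apply: filterS cc' => x e Ox; rewrite e.
Qed.

Lemma smooth_L2 psi : smooth psi -> L2 Omega psi.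
Proof.
move=> s1; apply: L2_bounded => //.
  by apply: measurable_funTS; exact: smooth_measurable.
by apply: continuous_bounded => //; exact: (Ck_continuous (s1 0)).
Qed.

Lemma smoothv_L2v phi : smoothv phi -> L2v Omega phi.
Proof. by move=> [s1 s2]; split; exact: smooth_L2. Qed.

(** A sum of indicators is measurable whatever happens on the edges, where it is
    zero. *)
Definition elementwise (k : cell Th -> plane R) (x : plane R) : plane R :=
  \sum_w \1_((triangle (vtx w))°) x *: k w.

Lemma elementwiseE k w x : (triangle (vtx w))° x -> elementwise k x = k w.
Proof.
move=> Tx; rewrite /elementwise (bigD1 w)//= big1 => [|w' w'w].
  by rewrite indicE mem_set// scale1r addr0.
rewrite indicE memNset ?scale0r// => Tx'; move: w'w.
by rewrite (interior_triangle_disjoint Tx' Tx) eqxx.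
Qed.

Lemma L2v_elementwise k : L2v Omega (elementwise k).
Proof.
have H (p : plane R -> R) : (forall (a : R) z, p (a *: z) = a * p z) ->
    (forall y z, p (y + z) = p y + p z) -> p 0 = 0 ->
    L2 Omega (fun x => p (elementwise k x)).
  move=> pZ pD p0.
  have E x : p (elementwise k x) = \sum_w \1_((triangle (vtx w))°) x * p (k w).
    rewrite /elementwise (big_morph p pD p0).
    by apply: eq_bigr => w _; rewrite pZ.
  apply: L2_bounded => //.
    rewrite (_ : (fun x => _) =
      fun x => \sum_w \1_((triangle (vtx w))°) x * p (k w)); last exact/funext.
    apply: measurable_sum => w; apply: measurable_funM => //.
    by apply: measurable_indic; exact: measurable_interior_triangle.
  exists (\sum_w `|p (k w)|); split; first exact: num_real.
  move=> y ky x _; rewrite /= E; apply: le_trans (ltW ky).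
  apply: le_trans (ler_norm_sum _ _ _) _; apply: ler_sum => w _.
  rewrite normrM indicE; case: (_ \in _); first by rewrite normr1 mul1r.
  by rewrite normr0 mul0r.
by split; apply: H.
Qed.

Lemma lagrange1_coef r : lagrange1 Th r -> exists k : cell Th -> R * R * R,
  forall w x, triangle (vtx w) x -> r x = aff (k w).1.1 (k w).1.2 (k w).2 x.
Proof.
move=> [_ H]; have /choice[k kP] : forall w, exists k : R * R * R,
    forall x, triangle (vtx w) x -> r x = aff k.1.1 k.1.2 k.2 x.
  by move=> w; have [a [b [c abc]]] := H w; exists (a, b, c).
by exists k.
Qed.

Lemma is_curl_eq D r r' c : (forall x, D x -> r x = r' x) ->
  is_curl D r c -> is_curl D r' c.
Proof.
move=> rr' [Lc Hc]; split=> // phi sp cp; rewrite -Hc//.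
by apply: int2_eq => x Dx; rewrite rr'.
Qed.

(** Some weak curl exists by hypothesis, so it only has to be identified on each
    open triangle, and no jump across an edge has to be computed. *)
Lemma is_curl_elementwise r (k : cell Th -> R * R * R) : Hcurl Omega r ->
  (forall w x, triangle (vtx w) x -> r x = aff (k w).1.1 (k w).1.2 (k w).2 x) ->
  is_curl Omega r (elementwise (fun w => ((k w).2, - (k w).1.2))).
Proof.
move=> Hr rk; have Hc := curlP Hr.
set c0 := elementwise _.
have A w : {ae leb2, forall x, (triangle (vtx w))° x -> curl Omega r x = ((k w).2, - (k w).1.2)}.
  have oT : open (triangle (vtx w))° by exact: open_interior.
  have fT := leb2_interior_triangle lipO w.
  apply: (is_curl_unique oT fT (r := r)).
    exact: is_curlS mO (open_meas2 oT) (interior_triangle_sub lipO (w := w)) Hc.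
  apply: (@is_curl_eq _ (aff (k w).1.1 (k w).1.2 (k w).2)).
    by move=> x Tx; rewrite (rk w)//; exact: interior_subset.
  exact: is_curl_aff.
have B : {ae leb2, forall x, Omega x -> curl Omega r x = c0 x}.
  have : {ae leb2, forall x, forall w, (triangle (vtx w))° x ->
      curl Omega r x = ((k w).2, - (k w).1.2)}.
    by apply: filter_forall => w; exact: A.
  apply: filterS2 (ae_interior_triangle Th) => x h1 h2 Ox.
  have [w Tw] := h1 Ox; rewrite (h2 w Tw) /c0 (elementwiseE _ Tw)//.
split; first exact: L2v_elementwise.
move=> phi sp cp; have [Lc ->//] := Hc.
apply: int2_dot_ae => //; first exact: smoothv_L2v.
exact: L2v_elementwise.
Qed.

End Discrete.

(** * The discrete spaces *)

Section Spaces.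
Context {R : realType} (Omega : set (plane R)) (Th : mesh Omega).
Hypothesis lipO : lipschitz_domain Omega.
Variable bdp : set (plane R).
Local Notation mplane := (measurableTypeR R * measurableTypeR R)%type.
Implicit Types (w : cell Th) (r : plane R -> R) (q c : plane R -> plane R).

Let oO : open Omega := open_Omega lipO.
Let bO : bounded_set Omega := bounded_Omega lipO.
Let mO : meas2 Omega := meas2_Omega lipO.
Let fO : (leb2 Omega < +oo)%E := leb2_Omega lipO.

Lemma Hcurl_L2v_curl r : Hcurl Omega r -> L2v Omega (curl Omega r).
Proof. by move=> /curlP[]. Qed.

Lemma spaceRh0 : spaceRh Th bdp (fun=> 0).
Proof.
split; first split.
- exact: continuous_subspaceT (@cst_continuous _ _ 0).
- by move=> w; exists 0, 0, 0 => x _; rewrite !mul0r !addr0.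
have H0 : Hcurl Omega (fun=> 0 : R).
  by split; [exact: L20|exists (fun=> 0); exact: is_curl0].
split=> // phi sp _; rewrite /ttrace_pair.
rewrite [X in _ - X]int2_0; last by move=> x _; rewrite mul0r.
rewrite subr0 (int2_dot_ae lipO (smoothv_L2v lipO sp) (Hcurl_L2v_curl H0) (L2v0 mO)).
  by apply: int2_0 => x _; rewrite /dot /= !mul0r addr0.
exact: curl_ae oO fO (is_curl0 lipO).
Qed.

Lemma Hdiv0 : Hdiv Omega (fun=> 0 : plane R).
Proof. by split; [exact: L2v0|exists (fun=> 0); exact: is_div0]. Qed.

Lemma div_int0 q p : is_div Omega q (fun=> 0) -> L2 Omega p ->
  int2 Omega (fun x => p x * div Omega q x) = 0.
Proof.
move=> Hq Lp; have [Ld _] : is_div Omega q (div Omega q).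
  by apply: xgetPex; exists (fun=> 0).
apply: (int2_ae0 lipO); first by apply: measurable_funM; exact: L2_measurable.
by apply: filterS (div_ae oO fO Hq) => x e Ox; rewrite e// mulr0.
Qed.

Lemma spaceQh0 : spaceQh Th bdp (fun=> 0).
Proof.
split; first by split; [exact: Hdiv0|move=> w; exists 0, 0 => x _; rewrite !mul0r !addr0].
split; first exact: Hdiv0.
move=> psi sp _; rewrite /ntrace_pair int2_0; last by move=> x _; rewrite /dot /= !mul0r addr0.
rewrite add0r -(div_int0 (is_div0 lipO) (smooth_L2 lipO sp)).
by apply: int2_eq => x _; rewrite mulrC.
Qed.

Lemma spacePh0 : spacePh Th (fun=> 0).
Proof. by split; [move=> w; exists 0|exact: L20]. Qed.

Lemma spaceRhB r r' : spaceRh Th bdp r -> spaceRh Th bdp r' ->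
  spaceRh Th bdp (fun x => r x - r' x).
Proof.
move=> [[cr ar] [Hr tr]] [[cr' ar'] [Hr' tr']]; split; first split.
- by move=> x; apply: (@continuousB _ _ _ (r : subspace (closure Omega) -> R) r' x (cr x) (cr' x)).
- move=> w; have [a [b [c E]]] := ar w; have [a' [b' [c' E']]] := ar' w.
  by exists (a - a'), (b - b'), (c - c') => x Tx; rewrite E// E'//; ring.
have [Lr _] := Hr; have [Lr' _] := Hr'.
have HB := is_curlB mO bO Lr Lr' (curlP Hr) (curlP Hr').
have H : Hcurl Omega (fun x => r x - r' x).
  by split; [exact: L2B|eexists; exact: HB].
split=> // phi sp vp; rewrite /ttrace_pair.
have Lp := smoothv_L2v lipO sp.
have Lc := Hcurl_L2v_curl Hr; have Lc' := Hcurl_L2v_curl Hr'.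
have [LB _] := HB.
rewrite (int2_dot_ae lipO Lp (Hcurl_L2v_curl H) LB (curl_ae oO fO HB)).
have ccu := smooth_ccurl sp.
rewrite (@int2_eq _ _ _ (fun x =>
    dot (curl Omega r x) (phi x) - dot (curl Omega r' x) (phi x))); last first.
  by move=> x _; rewrite /dot /=; ring.
rewrite [X in _ - X](@int2_eq _ _ _ (fun x => r x * ccurl phi x - r' x * ccurl phi x)); last first.
  by move=> x _; rewrite mulrBl.
rewrite int2B//; [|exact: integrable_dot|exact: integrable_dot].
rewrite int2B//; [|by apply: L2M => //; exact: smooth_L2|by apply: L2M => //; exact: smooth_L2].
have e : int2 Omega (fun x => dot (curl Omega r x) (phi x)) = _ := subr0_eq (tr phi sp vp).
have e' : int2 Omega (fun x => dot (curl Omega r' x) (phi x)) = _ := subr0_eq (tr' phi sp vp).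
by rewrite e e' subrr.
Qed.

Lemma vanishes_near_cgrad S (psi : plane R -> R) : vanishes_near S psi ->
  vanishes_near S (cgrad psi).
Proof.
move=> [U [oU SU p0]]; exists U; split=> // x Ux.
have n0 : \near x, cst 0 x = psi x.
  have : nbhs x U by exact: open_nbhs_nbhs.
  by apply: filterS => y Uy; rewrite p0.
rewrite /cgrad /d1 /d2.
rewrite -(near_eq_derive ((1, 0) : plane R) n0) -(near_eq_derive ((0, 1) : plane R) n0).
by rewrite !derive_cst.
Qed.

Lemma compactly_supported_cgrad D (psi : plane R -> R) :
  compactly_supported D psi -> compactly_supported D (cgrad psi).
Proof.
move=> cp; have [K [cK KD p0]] := cp; exists K; split=> // x nK.
have n0 := compactly_supported_near0 cK p0 nK.
rewrite /cgrad /d1 /d2.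
rewrite -(near_eq_derive ((1, 0) : plane R) n0) -(near_eq_derive ((0, 1) : plane R) n0).
by rewrite !derive_cst.
Qed.

(** The curl of a gradient is zero. *)
Lemma is_div_curl r c : is_curl Omega r c -> is_div Omega c (fun=> 0).
Proof.
move=> [Lc Hc]; split=> [|psi sp cp]; first exact: L20.
rewrite -Hc; [|exact: smooth_cgrad|exact: compactly_supported_cgrad].
rewrite ccurl_cgrad// !int2_0 ?oppr0// => x _; [by rewrite mul0r|by rewrite mulr0].
Qed.

(** The normal trace of the curl of [r] against [psi] is the tangential trace of
    [r] against the gradient of [psi], which vanishes on every open set where
    [psi] does. *)
Lemma spaceQh_curl r (k : cell Th -> plane R) : spaceR Omega bdp r ->
  is_curl Omega r (elementwise k) -> spaceQh Th bdp (elementwise k).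
Proof.
move=> [Hr tr] Hk; have dk := is_div_curl Hk.
have [Lk _] := Hk.
have Hd : Hdiv Omega (elementwise k) by split=> //; exists (fun=> 0).
split; split=> //.
  move=> w; exists (k w), 0 => x Tx; rewrite (elementwiseE k Tx).
  by rewrite !mul0r !addr0 -surjective_pairing.
move=> psi sp vp; rewrite /ntrace_pair.
rewrite [X in _ + X](@int2_eq _ _ _ (fun x => psi x * div Omega (elementwise k) x)); last first.
  by move=> x _; rewrite mulrC.
rewrite (div_int0 dk (smooth_L2 lipO sp)) addr0.
have sg := smooth_cgrad sp.
have := tr _ sg (vanishes_near_cgrad vp); rewrite /ttrace_pair ccurl_cgrad//.
rewrite [X in _ - X]int2_0; last by move=> x _; rewrite mulr0.
by rewrite subr0 (int2_dot_ae lipO (smoothv_L2v lipO sg) (Hcurl_L2v_curl Hr) Lk (curl_ae oO fO Hk)).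
Qed.

Lemma lagrange1_integral r : lagrange1 Th r -> L2 Omega r ->
  int2 Omega r = quad (fun _ : cell Th => r) (fun _ _ => 1).
Proof.
move=> [_ ar] Lr; rewrite (int2_mesh Th lipO); last exact: L2_integrable.
apply: eq_bigr => w _; have [a [b [c E]]] := ar w.
rewrite (quadrature_exact (vtx_ccw w) (leb2_interior_triangle lipO w) E).
by congr (_ * _); apply: eq_bigr => i _; rewrite mulr1.
Qed.

Lemma vtx_closure w i : closure Omega (vtx w i).
Proof.
rewrite (mesh_cover Th); exists w => //.
apply/(triangleP _ (vtx_det_neq0 w)) => j.
have [->|ij] := eqVneq i j; first by rewrite bary_vtx// vtx_det_neq0.
have d0 := vtx_det_neq0 w; rewrite /bary divr_ge0//; last exact/ltW/vtx_ccw.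
by move: ij; case: (ord3P i) => ->; case: (ord3P j) => ->; rewrite ?eqxx// !ordSE => _;
  rewrite /crossv /= ?subrr ?mul0r ?mulr0 subrr.
Qed.

Lemma cell_exists : exists w : cell Th, True.
Proof.
case: lipO => -[x Ox] _ _ _ _.
have : closure Omega x by exact: subset_closure.
by rewrite (mesh_cover Th) => -[w _ _]; exists w.
Qed.

Lemma area_gt0 w : 0 < area w.
Proof. by rewrite divr_gt0// vtx_ccw. Qed.

Lemma total_area_gt0 : 0 < \sum_(w : cell Th) area w.
Proof.
have [w _] := cell_exists.
rewrite (bigD1 w)//= ltr_pwDl ?area_gt0// sumr_ge0// => w' _.
exact/ltW/area_gt0.
Qed.

(** The image of the connected closure is an interval with finitely many
    points. *)
Lemma lagrange1_flat_cst r (k : cell Th -> R) :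
  {within closure Omega, continuous r} ->
  (forall w x, triangle (vtx w) x -> r x = k w) ->
  exists kap, forall x, closure Omega x -> r x = kap.
Proof.
move=> cr rk.
have [x0 Ox0] : closure Omega !=set0.
  by case: lipO => -[x Ox] _ _ _ _; exists x; exact: subset_closure.
exists (r x0) => x Ox.
have cO : connected (closure Omega).
  by apply: connected_closure; case: lipO.
have /connected_intervalP itv : connected (r @` closure Omega).
  exact: connected_continuous_connected.
have sub : r @` closure Omega `<=` range k.
  by move=> _ [y + <-]; rewrite (mesh_cover Th) => -[w _ Tw]; exists w => //; rewrite (rk w).
have cnt : countable (range k).
  exact/finite_set_countable/finite_image/finite_finset.
have key a b : (r @` closure Omega) a -> (r @` closure Omega) b -> a < b -> False.
  move=> Ia Ib ab; have : `[a, b]%classic `<=` range k.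
    move=> y; rewrite /= in_itv /= => yab; apply: sub; exact: (itv a b).
  move=> /subset_card_le/sub_countable/(_ cnt)/countable_lebesgue_measure0.
  rewrite lebesgue_measure_itv /= lte_fin ab -EFinB => -[] /eqP.
  by rewrite subr_eq0 gt_eqF.
have [h|h|//] := ltgtP (r x) (r x0).
  by case: (key _ _ (imageP r Ox) (imageP r Ox0) h).
by case: (key _ _ (imageP r Ox0) (imageP r Ox) h).
Qed.

End Spaces.

(** * The two test triples *)

Section Tests.
Context {R : realType} (Omega : set (plane R)) (Th : mesh Omega).
Hypothesis lipO : lipschitz_domain Omega.
Variables (bdp : set (plane R)) (mu : R).
Implicit Types (r : plane R -> R) (q c : plane R -> plane R).

Let oO : open Omega := open_Omega lipO.
Let bO : bounded_set Omega := bounded_Omega lipO.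
Let mO : meas2 Omega := meas2_Omega lipO.
Let fO : (leb2 Omega < +oo)%E := leb2_Omega lipO.

Lemma int2_dot_curl0 q r : L2v Omega q -> is_curl Omega r (fun=> 0) ->
  int2 Omega (fun x => dot (q x) (curl Omega r x)) = 0.
Proof.
move=> Lq Hr.
have [Lc _] : is_curl Omega r (curl Omega r) by apply: xgetPex; exists (fun=> 0).
apply: (int2_ae0 lipO); first exact: L2v_measurable_dot.
apply: filterS (curl_ae oO fO Hr) => x e Ox.
by rewrite e// /dot /= !mulr0 addr0.
Qed.

Lemma bil_test_velo (x : triple R) q : spaceXh Th bdp x ->
  is_div Omega q (fun=> 0) ->
  let y := Triple (fun=> 0) q (fun=> 0) in
  bilB Omega mu x y = int2 Omega (fun z => dot (curl Omega (vort x) z) (q z)) /\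
  bilBh Th mu x y = int2 Omega (fun z => dot (curl Omega (vort x) z) (q z)).
Proof.
move=> [_ [_ [[Lv _] _]] [_ Lp]] dq /=; rewrite /bilB /bilBh /=.
rewrite (int2_dot_curl0 Lv (is_curl0 lipO)) (div_int0 lipO dq Lp).
have Z f : int2 Omega (fun z => f z * 0) = 0.
  by apply: int2_0 => z _; rewrite mulr0.
rewrite (Z (fun z => mu^-1 * vort x z)) (Z (div Omega (velo x))).
rewrite !subr0 !addr0 add0r; split=> //.
rewrite /quad big1 ?add0r// => w _; rewrite big1 ?mulr0// => k _.
exact: mulr0.
Qed.

Lemma bil_test_vort (x : triple R) r : spaceXh Th bdp x ->
  is_curl Omega r (fun=> 0) ->
  let y := Triple r (fun=> 0) (fun=> 0) in
  bilB Omega mu x y = int2 Omega (fun z => mu^-1 * vort x z * r z) /\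
  bilBh Th mu x y = quad (fun (_ : cell Th) z => mu^-1 * vort x z) (fun=> r).
Proof.
move=> [_ [_ [[Lv _] _]] [_ Lp]] cr /=; rewrite /bilB /bilBh /=.
rewrite (int2_dot_curl0 Lv cr) (div_int0 lipO (is_div0 lipO) Lp).
rewrite (@int2_0 _ Omega (fun z => dot _ 0)); last first.
  by move=> z _; rewrite /dot /= !mulr0 addr0.
rewrite (@int2_0 _ Omega (fun z => _ * 0)); last by move=> z _; rewrite mulr0.
by rewrite !subr0 !addr0.
Qed.

Lemma int2_dot_elementwise (k : cell Th -> plane R) :
  int2 Omega (fun x => dot (elementwise k x) (elementwise k x)) =
  \sum_w area w * dot (k w) (k w).
Proof.
have [Lk1 Lk2] := L2v_elementwise lipO k.
rewrite (int2_mesh Th lipO); last exact: integrable_dot.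
apply: eq_bigr => w _.
rewrite (@int2_eq _ _ _ (fun=> dot (k w) (k w))); last first.
  by move=> x Tx; rewrite (elementwiseE k Tx).
rewrite (@quadrature_exact _ _ _ (dot (k w) (k w)) 0 0 (vtx_ccw w) (leb2_interior_triangle lipO w)).
  by rewrite sum3 /area; field.
by move=> x _; rewrite !mul0r !addr0.
Qed.

Lemma dot_ge0 (u : plane R) : 0 <= dot u u.
Proof. by rewrite addr_ge0// -expr2 sqr_ge0. Qed.

Lemma dot_eq0 (u : plane R) : dot u u = 0 -> u = 0.
Proof.
move=> /eqP; rewrite paddr_eq0 -?expr2 ?sqr_ge0// !sqrf_eq0 => /andP[/eqP a /eqP b].
by rewrite [u]surjective_pairing a b.
Qed.

End Tests.

Theorem corollary4p4p1 (R : realType) (Omega : set (plane R))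
  (hOmega : lipschitz_domain Omega) (hsc : simply_connected Omega)
  (bdp bdq : set (plane R))
  (hbd : bdp `|` bdq = bdry Omega) (hdisj : bdp `&` bdq = set0)
  (hmp : meas2 bdp) (hmq : meas2 bdq) (hp : bdp !=set0)
  (Th : mesh Omega) (sigma : R) (hreg : shape_regular Th sigma)
  (hrigid : no_rigid_motion Th bdp bdq)
  (mu : R) (hmu : 0 < mu)
  (g : plane R -> plane R) (hg : L2v Omega g)
  (q0 : plane R -> plane R) (p0 : plane R -> R)
  (hf : load_bounded Th bdp q0 p0 g)
  (xhat xh : triple R)
  (hxhat : spaceXh Th bdp xhat) (hxh : spaceXh Th bdp xh)
  (hsolhat : forall y, spaceXh Th bdp y ->
     bilB Omega mu xhat y = load Th bdp q0 p0 g y)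
  (hsolh : forall y, spaceXh Th bdp y ->
     bilBh Th mu xh y = load Th bdp q0 p0 g y) :
  forall z, closure Omega z -> vort xh z = vort xhat z.
Proof.
have eqB y : spaceXh Th bdp y -> bilBh Th mu xh y = bilB Omega mu xhat y.
  by move=> hy; rewrite hsolh// hsolhat.
have mO := meas2_Omega hOmega; have oO := open_Omega hOmega.
have bO := bounded_Omega hOmega; have fO := leb2_Omega hOmega.
have [Rh _ _] := hxh; have [Rhat _ _] := hxhat.
set rh := vort xh in Rh *; set rhat := vort xhat in Rhat *.
pose d z := rh z - rhat z.
have Rd : spaceRh Th bdp d by exact: spaceRhB.
have [[cd _] [Hd _]] := Rd.
have [k dk] := lagrange1_coef Rd.1.
pose kc w := ((k w).2, - (k w).1.2).
have curld := is_curl_elementwise hOmega Hd dk; rewrite -/kc in curld.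
have [_ [Hrh _]] := Rh; have [_ [Hrhat _]] := Rhat.
have Lk := L2v_elementwise hOmega kc.
have curlB : {ae leb2, forall x, Omega x ->
    curl Omega rh x - curl Omega rhat x = elementwise kc x}.
  apply: (is_curl_unique oO fO _ curld).
  exact: is_curlB mO bO Hrh.1 Hrhat.1 (curlP Hrh) (curlP Hrhat).
(* Tested with the curl of [d], the difference of the equations gives
   the square of its norm. *)
have kc0 w : kc w = 0.
  pose y := Triple (fun=> 0) (elementwise kc) (fun=> 0).
  have Xy : spaceXh Th bdp y.
    by split; [exact: spaceRh0|exact: (spaceQh_curl hOmega Rd.2 curld)|exact: spacePh0].
  have dq := is_div_curl hOmega curld.
  have := eqB _ Xy.
  rewrite (bil_test_velo hOmega mu hxh dq).2 (bil_test_velo hOmega mu hxhat dq).1.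
  rewrite -/rh -/rhat => /eqP; rewrite -subr_eq0 -int2B//; last 2 first.
  - exact: integrable_dot (Hcurl_L2v_curl Hrh) Lk.
  - exact: integrable_dot (Hcurl_L2v_curl Hrhat) Lk.
  rewrite (@int2_eq _ _ _ (fun z =>
      dot (curl Omega rh z - curl Omega rhat z) (elementwise kc z))); last first.
    by move=> z _; rewrite /dot /=; ring.
  have LB : L2v Omega (fun z => curl Omega rh z - curl Omega rhat z).
    have [a1 a2] := Hcurl_L2v_curl Hrh; have [b1 b2] := Hcurl_L2v_curl Hrhat.
    by split; [exact: (L2B mO a1 b1)|exact: (L2B mO a2 b2)].
  rewrite (int2_dot_ae hOmega Lk LB Lk curlB) int2_dot_elementwise//.
  rewrite psumr_eq0 => [|i _]; last by rewrite mulr_ge0 ?dot_ge0// ltW// area_gt0.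
  move=> /allP/(_ w); rewrite mem_index_enum => /(_ isT).
  by rewrite mulf_eq0 gt_eqF ?area_gt0//= => /eqP/dot_eq0.
have flat w x : triangle (vtx w) x -> d x = (k w).1.1.
  move=> Tx; rewrite (dk w x Tx) /aff.
  have := kc0 w; rewrite /kc => -[-> /eqP]; rewrite oppr_eq0 => /eqP ->.
  by rewrite !mul0r !addr0.
have [kap dkap] := lagrange1_flat_cst hOmega cd flat.
suff kap0 : kap = 0.
  by move=> z Oz; apply/eqP; rewrite -subr_eq0 -/(d z) dkap// kap0.
have curld0 : is_curl Omega d (fun=> 0).
  rewrite (_ : (fun=> 0) = elementwise kc)//; apply/funext => x.
  by rewrite /elementwise big1// => w _; rewrite kc0 scaler0.
(* The constant [d] is itself an admissible test function. *)
pose y := Triple d (fun=> 0) (fun=> 0).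
have Xy : spaceXh Th bdp y.
  by split; [exact: Rd|exact: spaceQh0|exact: spacePh0].
have := eqB _ Xy.
rewrite (bil_test_vort hOmega mu hxh curld0).2.
rewrite (bil_test_vort hOmega mu hxhat curld0).1.
rewrite -/rh -/rhat.
have irh := L2_integrable mO fO Hrh.1; have irhat := L2_integrable mO fO Hrhat.1.
have -> : quad (fun (_ : cell Th) z => mu^-1 * rh z) (fun=> d) = mu^-1 * kap * int2 Omega rh.
  rewrite (lagrange1_integral hOmega Rh.1 Hrh.1) /quad mulr_sumr; apply: eq_bigr => w _.
  rewrite mulrCA; congr (_ * _); rewrite mulr_sumr; apply: eq_bigr => i _.
  by rewrite dkap; [ring|exact: vtx_closure].
rewrite (@int2_eq _ _ (fun z => mu^-1 * rhat z * d z) (fun z => mu^-1 * kap * rhat z)); last first.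
  by move=> z Oz; rewrite dkap; [ring|exact: subset_closure].
rewrite int2Zl// => /eqP; rewrite -subr_eq0 -mulrBr -int2B//.
rewrite (@int2_eq _ _ _ (fun=> kap)); last first.
  by move=> z Oz; rewrite -/(d z) dkap//; exact: subset_closure.
have -> : int2 Omega (fun=> kap) = kap * \sum_(w : cell Th) area w.
  rewrite (@lagrange1_integral _ _ Th hOmega); last 2 first.
  - split; first exact: continuous_subspaceT (@cst_continuous _ _ kap).
    by move=> w; exists kap, 0, 0 => x _; rewrite !mul0r !addr0.
  - exact: L2_cst.
  rewrite /quad mulr_sumr; apply: eq_bigr => w _.
  by rewrite sum3; field.
rewrite !mulf_eq0 invr_eq0 (gt_eqF hmu) (gt_eqF (total_area_gt0 Th hOmega)) orbF /= orbb.
by move/eqP.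
Qed.
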